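(* Let $\{G_N=(V_N,E_N):N\ge1\}$ be a sequence of random graphs, $|V_N|=N$, defined on a probability space $(\Omega,\mathcal F,\mathbb P)$. Assume that there are an integer $d\ge3$ and constants $\alpha_0>0$, $\gamma>0$ not depending on $N$ such that, with $\mathbb P$-probability converging to $1$ as $N\to\infty$, the following three properties hold simultaneously: (G1) $G_N$ is $d$-regular; (G2) for any vertex $x\in V_N$, the ball $B(x,\alpha_0\log N)$ contains at most one cycle; (G3) the spectral gap $\lambda_N$ of the (rate one) continuous-time simple random walk on $G_N$ satisfies $\lambda_N\ge\gamma$. Put i.i.d. heavy-tailed weights on the vertices as described in the context. Then, with $L_N=\log N$ and $\ell_N=\alpha'\log N$ for some $0<\alpha'<\min\{\alpha_0,[2\log(d-1)]^{-1}\}$: (i) if $\mathfrak x,\mathfrak y$ are chosen independently and uniformly in $V_N$, then $\lim_{N\to\infty}\mathbb P[(\mathfrak x,B(\mathfrak x,\ell_N))\not\equiv(\mathfrak y,B(\mathfrak y,\ell_N))]=0$; (ii) for every increasing sequence of integers $J_N$ with $J_N\to\infty$, $\lim_{N\to\infty}\mathbb E[\nu_N(\{x^N_1,\dots,x^N_{\min\{J_N,|V_N|\}}\}^c)]=0$; (iii) for $\mathfrak x$ uniform in $V_N$, $\lim_{N\to\infty}\mathbb E[|B(\mathfrak x,2\ell_N)|/|V_N|]=0$; (iv) for $\mathfrak x$ uniform in $V_N$, $\lim_{N\to\infty}\mathbb E\big[\sup_{y\notin B(\mathfrak x,\ell_N)}\mathbf P^N_y[\mathbb H_{\mathfrak x}\le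 L_Nt^N_{\mathrm{mix}}]\big]=0$.
   Context: Graphs are finite, unoriented and connected. Weights: $\{W^N_j:j\ge1\}$ are i.i.d. strictly positive random variables independent of $G_N$, with law not depending on $N$ and $\mathbb P[W^N_1>t]=L(t)t^{-\alpha}$, $t>0$, where $0<\alpha<1$ and $L$ is slowly varying at infinity. $\hat W^N_1\ge\dots\ge\hat W^N_{|V_N|}$ is the decreasing rearrangement of $W^N_1,\dots,W^N_{|V_N|}$, $(x^N_1,\dots,x^N_{|V_N|})$ is a uniformly random enumeration of $V_N$ (independent of the weights), and $W^N_{x^N_j}=\hat W^N_j$. $\nu_N(x)=\deg(x)W^N_x/\sum_{y\in V_N}\deg(y)W^N_y$. $B(x,\ell)$ is the ball of radius $\ell$ about $x$ in graph distance. $\mathbf P^N_x$ is the law (given the graph) of the lazy discrete-time random walk on $G_N$ started at $x$ (stay with probability $1/2$, otherwise jump to a uniform neighbor); $\mathbb H_x$ is its hitting time of $x$; $t^N_{\mathrm{mix}}$ is its mixing time, i.e. the least $t$ such that the maximum over starting points of the total variation distance between the law at time $t$ and the stationary law is at most $1/4$. A supremum over an empty set is $0$. $(\mathfrak x,A)\equiv(\mathfrak y,B)$, for $\mathfrak x\in A\subset V_N$, $\mathfrak y\in B\subset V_N$, means there is a bijection $\varphi:A\to B$ with $\varphi(\mathfrak x)=\mathfrak y$ such that $\{a,b\}\in E_N$ iff $\{\varphi(a),\varphi(b)\}\in E_N$ for all $a,b\in A$. *)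

(* Defs.v *)
From HB Require Import structures.
From mathcomp Require Import all_boot all_order all_algebra finmap.
From mathcomp Require Import all_classical all_reals all_analysis.

Set Implicit Arguments.
Unset Strict Implicit.
Unset Printing Implicit Defensive.

Import Order.TTheory GRing.Theory Num.Theory.
Import numFieldNormedType.Exports.

Local Open Scope classical_set_scope.
Local Open Scope ring_scope.

(* A graph on the vertex set V is given by its edge set E : {set {set V}}. *)
Section Graphs.
Variables (V : finType) (E : {set {set V}}).

Definition simple_graph : bool := [forall e in E, #|e| == 2%N].

Definition adj : rel V := fun x y => [set x; y]%SET \in E.

Definition connected_graph : bool := [forall x, forall y, connect adj x y].

Definition deg (x : V) : nat := #|[set y | adj x y]%SET|.

Definition regular_graph (d : nat) : bool := [forall x, deg x == d].

(* The least length of a path from x to y; a shortest path visits each vertex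
   at most once, so lengths below #|V| suffice.  The value is #|V| if y is not
   reachable from x. *)
Definition gdist (x y : V) : nat :=
  find (fun k => [exists p : k.-tuple V, path adj x p && (last x p == y)])
       (iota 0 #|V|).

Definition gball (R : realType) (x : V) (r : R) : {set V} :=
  [set y | (gdist x y)%:R <= r]%SET.

(* The sequence c lists, in cyclic order, the vertices of a cycle of the
   subgraph induced by A. *)
Definition is_cycle (A : {set V}) (c : seq V) : bool :=
  [&& (2 < size c)%N, cycle adj c, uniq c & all [in A] c].

Definition cycle_edges (c : seq V) : {set {set V}} :=
  [set [set x; next c x] | x in c]%SET.

(* Two sequences describe the same cycle when they differ by a rotation or a
   reversal, that is, when they have the same edges. *)
Definition at_most_one_cycle (A : {set V}) : Prop :=
  forall c c', is_cycle A c -> is_cycle A c' -> cycle_edges c = cycle_edges c'.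

Definition pointed_equiv (x : V) (A : {set V}) (y : V) (B : {set V}) : Prop :=
  exists f : V -> V,
    [/\ {in A &, injective f}, (f @: A)%SET = B, f x = y &
        {in A &, forall a b, adj (f a) (f b) = adj a b}].

End Graphs.

Section Walks.
Variables (R : realType) (V : finType) (E : {set {set V}}).

(* Isolated vertices do not occur in a connected graph with at least two
   vertices; for them, the quotients by the degree below are 0. *)

(* Generator of the rate one continuous-time simple random walk. *)
Definition srw_generator : 'M[R]_#|V| :=
  \matrix_(i, j) ((adj E (enum_val i) (enum_val j))%:R
                    / (deg E (enum_val i))%:R
                  - (i == j)%:R).

(* The smallest nonzero eigenvalue of minus the generator.  All its eigenvalues
   are real because the walk is reversible, and, the graph being connected,
   0 is a simple one. *)
Definition spectral_gap : R :=
  inf [set a : R | eigenvalue (- srw_generator) a /\ a != 0].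

Definition lazy_step (x y : V) : R :=
  (x == y)%:R / 2 + (adj E x y)%:R / (2 * (deg E x)%:R).

Fixpoint traj_weight (x : V) (w : seq V) : R :=
  if w is y :: w' then lazy_step x y * traj_weight y w' else 1.

(* The probability that the first n steps (X_1, ..., X_n) of the lazy walk
   started at X_0 = x satisfy A. *)
Definition walk_prob (x : V) (n : nat) (A : pred (n.-tuple V)) : R :=
  \sum_(w : n.-tuple V | A w) traj_weight x w.

Definition walk_law (x : V) (t : nat) (y : V) : R :=
  walk_prob x [pred w : t.-tuple V | last x w == y].

(* The hitting time of x, at least 0, is index x (X_0 :: X_1 :: ...).  The
   event H_x <= s only involves the first n steps, n being the integer part of
   s >= 0; index is n.+1 if these do not meet x. *)
Definition hit_prob (y x : V) (s : R) : R :=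
  walk_prob y
    [pred w : (Num.truncn s).-tuple V | (index x (y :: w) <= Num.truncn s)%N].

Definition stationary (y : V) : R := (deg E y)%:R / (\sum_(z : V) deg E z)%:R.

Definition tv_dist (mu nu : V -> R) : R :=
  \big[Num.max/0]_(A : {set V}) `| \sum_(y in A) mu y - \sum_(y in A) nu y |.

Definition mixed (t : nat) : bool :=
  \big[Num.max/0]_(x : V) tv_dist (walk_law x t) stationary <= 4^-1.

(* By convention 0 if there is no such t, which does not happen for a connected
   graph. *)
Definition mixing_time : nat :=
  if pselect (exists t, mixed t) is left h then ex_minn h else 0%N.

End Walks.

Section Weights.
Variables (R : realType) (V : finType).

(* If xs enumerates V, the vertex xs_j receives the j-th largest element
   of ws. *)
Definition vertex_weight (ws : seq R) (xs : seq V) (x : V) : R :=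
  nth 0 (sort (fun a b => b <= a) ws) (index x xs).

Definition trap_measure (E : {set {set V}}) (wt : V -> R) (x : V) : R :=
  (deg E x)%:R * wt x / \sum_(y : V) (deg E y)%:R * wt y.

End Weights.

Definition slowly_varying (R : realType) (L : R -> R) : Prop :=
  (\forall t \near +oo, 0 < L t) /\
  forall a : R, 0 < a -> L (a * t) / L t @[t --> +oo] --> (1 : R).

Section Probability.
Context (disp : measure_display) (Omega : measurableType disp) (R : realType).
Variable P : probability Omega R.

Definition finite_rv (T : finType) (X : Omega -> T) : Prop :=
  forall t, measurable (X @^-1` [set t]).

Definition uniform_on (T : finType) (X : Omega -> T) (A : {set T}) : Prop :=
  forall t, P (X @^-1` [set t]) = (if t \in A then #|A|%:R^-1 else 0)%:E.

Definition mutually_independent (I : choiceType) (F : I -> set (set Omega)) :=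
  forall (J : {fset I}) (A : I -> set Omega),
    (forall i, i \in J -> F i (A i)) ->
    P (\bigcap_(i in [set` J]) A i) = (\prod_(i <- J) P (A i))%E.

(* The events generated by a random element with values in a finite type. *)
Definition finite_events (T : finType) (X : Omega -> T) : set (set Omega) :=
  preimage_set_system setT X setT.

Definition real_events (X : Omega -> R) : set (set Omega) :=
  preimage_set_system setT X measurable.

End Probability.

(* Main.v *)
Require Import Defs.
From HB Require Import structures.
From mathcomp Require Import all_boot all_order all_algebra finmap.
From mathcomp Require Import all_classical all_reals all_analysis.
From mathcomp Require Import zify ring lra.

Set Implicit Arguments.
Unset Strict Implicit.
Unset Printing Implicit Defensive.

Import Order.TTheory GRing.Theory Num.Theory.
Import numFieldNormedType.Exports.

Local Open Scope ring_scope.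

(* A connected acyclic set S of vertices spans |S| - 1 edges, and a set with at
   most one cycle spans at most |S| edges.  In a d-regular graph whose balls of
   radius alpha0 log N contain at most one cycle, the number of centers whose ball
   contains a given cycle is therefore multiplied by at least d - 1 when the radius
   grows by 1, so that all but a vanishing fraction of the balls of radius
   alpha' log N < alpha0 log N are trees, and two such balls are isomorphic: (i).
   Part (iii) is the growth bound 1 + d (d - 1)^r for balls.  For (iv), the gap
   gives p_k(y, x) <= 1/N + s^k with s < 1, hence a mixing time O(log N), and
   p_k(y, x) vanishes for k < dist(y, x); a union bound over times concludes.
   For (ii), let a_m = P(W > 2^m), whose successive ratios tend to 2^(-alpha), in
   the interval (1/2, 1).  With kappa in (2^alpha, 2) and a level 2^m exceeded by
   about kappa^p of the weights, the maximum exceeds 2^(m+p) with high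
   probability, since (2^(-alpha) kappa)^p is large, while the weights below 2^m
   have mean total mass O(kappa^p 2^m), a small fraction of 2^(m+p). *)

(** * Arcs and cycles *)

Section Arcs.
Local Open Scope set_scope.
Local Open Scope nat_scope.
Variables (V : finType).
Implicit Types (E : {set {set V}}) (A B C : {set V}).

(** For (i), cycles are tracked through their vertex sets Z. At the larger radius a ball contains at
    most one cycle, so the sets of centers attached to distinct Z are disjoint and their sizes add
    up to at most N. Going back to the smaller radius gains, up to rounding, the factor (d -
    1)^((alpha0 - alpha') log N), a positive power of N. Edges are counted as ordered pairs of
    adjacent vertices, because sums over pairs split along disjoint unions of vertex sets. For (ii)
    to (iv), the measurability of the integrands is never established: each is bounded pointwise by
    an explicit measurable function, and the expectation is monotone on all nonnegative functions.
    In (ii), p and kappa^p depend only on the accuracy sought, while the level m varies with N. The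
    mean number of weights above 2^m thus stays bounded as J_N grows, and by Markov's inequality
    these weights are all among the J_N largest with high probability. The interval for kappa is
    nonempty because alpha < 1. *)

Definition arcs E A B : nat := \sum_(x in A) \sum_(y in B) adj E x y.

Definition acyclic_on E A : Prop := forall c, is_cycle E A c = false.

Lemma adj_sym E : symmetric (adj E).
Proof. by move=> x y; rewrite /adj finset.setUC. Qed.

Lemma adj_irrefl E x : simple_graph E -> adj E x x = false.
Proof.
move=> /forall_inP sE; apply/negP => /sE.
by rewrite finset.setUid cards1.
Qed.

Lemma arcsC E A B : arcs E A B = arcs E B A.
Proof.
rewrite /arcs exchange_big /=.
by apply: eq_bigr => x _; apply: eq_bigr => y _; rewrite adj_sym.
Qed.

Lemma arcsUl E A B C : [disjoint A & B] ->
  arcs E (A :|: B) C = arcs E A C + arcs E B C.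
Proof. by move=> AB; rewrite /arcs (eq_bigl [predU A & B]) ?bigU //= => x; rewrite !inE. Qed.

Lemma arcsUr E A B C : [disjoint B & C] ->
  arcs E A (B :|: C) = arcs E A B + arcs E A C.
Proof. by move=> BC; rewrite arcsC arcsUl // !(arcsC E A). Qed.

Lemma arcsUU E A B : [disjoint A & B] ->
  arcs E (A :|: B) (A :|: B) = arcs E A A + 2 * arcs E A B + arcs E B B.
Proof.
by move=> AB; rewrite arcsUl // !arcsUr // (arcsC E B A); lia.
Qed.

Lemma arcs_sub E A A' B B' : A \subset A' -> B \subset B' ->
  arcs E A B <= arcs E A' B'.
Proof.
move=> /finset.setIidPr AA' /finset.setIidPr BB'; rewrite /arcs.
rewrite [leqRHS](big_setID A) /= AA'; apply: leq_trans (leq_addr _ _).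
by apply: leq_sum => x _; rewrite [leqRHS](big_setID B) /= BB' leq_addr.
Qed.

Lemma arcs1 E x B : arcs E [set x] B = \sum_(y in B) adj E x y.
Proof. by rewrite /arcs big_set1. Qed.

Lemma is_cycleS E A B c : A \subset B -> is_cycle E A c -> is_cycle E B c.
Proof.
move=> /fintype.subsetP AB /and4P[c1 c2 c3 cA]; apply/and4P; split=> //.
by apply/allP => x /(allP cA) /AB.
Qed.

Lemma acyclic_onS E A B : A \subset B -> acyclic_on E B -> acyclic_on E A.
Proof.
by move=> AB aB c; apply/negP => /(is_cycleS AB); rewrite aB.
Qed.

Lemma at_most_one_cycleS E A B :
  A \subset B -> at_most_one_cycle E B -> at_most_one_cycle E A.
Proof. by move=> AB uB c c' /(is_cycleS AB) + /(is_cycleS AB); apply: uB. Qed.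

(* The start of a longest path has two neighbours, both on the path, and the
   further one closes a cycle. *)
Lemma min_degree2_cycle E A : simple_graph E -> A != finset.set0 ->
  (forall x, x \in A -> 1 < \sum_(y in A) adj E x y) ->
  exists c, is_cycle E A c.
Proof.
move=> sE /set0Pn[x0 x0A] deg2.
pose Q n := [exists p : n.-tuple V, [&& sorted (adj E) p, uniq p & all [in A] p]].
have Q1 : Q 1.
  apply/existsP; exists [tuple x0]; by rewrite /= x0A.
have Qub n : Q n -> n <= #|V|.
  move=> /existsP[p /and3P[_ up _]].
  by rewrite -(size_tuple p) -(card_uniqP up) max_card.
case: (ex_maxnP (ex_intro _ 1 Q1) Qub) => n /existsP[[p sp]] /= /and3P[pp up pA] nmax.
case: p sp pp up pA => [|x p] sp pp up pA.
  by have := nmax 1 Q1; rewrite -(eqP sp).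
have [xA pA'] : x \in A /\ all [in A] p by apply/andP.
have nbp y : y \in A -> adj E x y -> y \in p.
  move=> yA xy; apply/negPn/negP => yp.
  have yx : y != x by apply: contraTneq xy => ->; rewrite adj_irrefl.
  suff /nmax : Q n.+1 by rewrite ltnn.
  have sp' : size (y :: x :: p) == n.+1 by rewrite /= eqSS.
  apply/existsP; exists (Tuple sp') => /=.
  apply/and3P; split; first by rewrite /= adj_sym xy.
    by apply/andP; split; rewrite // inE negb_or yx yp.
  by apply/and3P; split.
have [y yA [xy iy]] : exists2 y, y \in A & adj E x y /\ 0 < index y p.
  apply: contrapT => noy.
  have := deg2 x xA; rewrite ltnNge => /negP; apply.
  have le1 y : y \in A -> adj E x y <= (y == head x p).
    move=> yA; case: (boolP (adj E x y)) => //= xy.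
    case: posnP => // /eqP; rewrite eqb0 => /negP yh; exfalso; apply: noy.
    exists y => //; split => //; have := nbp y yA xy.
    by case: (p) yh => //= z p' /negP /negPf; rewrite eq_sym => ->.
  apply: (@leq_trans (\sum_(y in A) (y == head x p))).
    exact: leq_sum.
  rewrite -big_mkcondr /=; first by rewrite sum1_card; apply: (@leq_trans #|pred1 (head x p)|);
    [apply: subset_leq_card; apply/fintype.subsetP => z /andP[] | rewrite card1].
have yp := nbp y yA xy.
exists (x :: take (index y p).+1 p).
have sz : index y p < size p by rewrite index_mem.
rewrite /is_cycle /= size_take_min.
have -> : minn (index y p).+1 (size p) = (index y p).+1 by apply/minn_idPl.
rewrite !ltnS iy xA /=.
move: up => /= /andP[xp up].
rewrite -andbA; apply/and4P; split.
- rewrite rcons_path take_path //=.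
  rewrite (take_nth x) // last_rcons nth_index // adj_sym //.
- by apply: contra xp; apply: mem_take.
- exact: take_uniq.
- by apply/allP => z /mem_take; apply: (allP pA').
Qed.

(** Each edge counts twice in [arcs E A A], so this is the bound |A| - 1 for forests. By
    [min_degree2_cycle] some vertex has at most one neighbour in A; deleting it removes at most two
    arcs. *)
Lemma acyclic_arcs E A : simple_graph E -> acyclic_on E A -> A != finset.set0 ->
  arcs E A A + 2 <= 2 * #|A|.
Proof.
move=> sE; move: {2}#|A| (leqnn #|A|) => n; elim: n A => [|n IH] A.
  by rewrite leqn0 cards_eq0 => /eqP-> _ /eqP.
move=> An aA A0.
have [x xA dx] : exists2 x, x \in A & \sum_(y in A) adj E x y <= 1.
  apply: contrapT => nox.
  have [|c] := min_degree2_cycle sE A0; last by rewrite aA.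
  by move=> x xA; rewrite ltnNge; apply/negP => dx; apply: nox; exists x.
have [A1|A1] := eqVneq (A :\ x) finset.set0.
  have -> : A = [set x] by rewrite -(finset.setD1K xA) A1 finset.setU0.
  by rewrite arcs1 big_set1 adj_irrefl // cards1.
have cA : #|A| = #|A :\ x|.+1 by rewrite (cardsD1 x) xA.
have := IH (A :\ x); rewrite -ltnS -cA => /(_ An (acyclic_onS (finset.subsetDl _ _) aA) A1).
have dis : [disjoint [set x] & A :\ x] by rewrite disjoints1 !inE eqxx.
rewrite cA; have -> : arcs E A A = arcs E (x |: A :\ x) (x |: A :\ x) by rewrite finset.setD1K.
rewrite arcsUU // arcs1 big_set1 adj_irrefl //.
have : arcs E [set x] (A :\ x) <= 1.
  by rewrite arcs1; apply: leq_trans dx; rewrite [leqRHS](big_setD1 x) //= leq_addl.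
lia.
Qed.

(* Deleting an edge of the cycle leaves an acyclic graph. *)
Lemma unicyclic_arcs E A : simple_graph E -> at_most_one_cycle E A ->
  arcs E A A <= 2 * #|A|.
Proof.
move=> sE uA.
have [A0|A0] := eqVneq A finset.set0.
  by rewrite A0 /arcs big_set0.
have [aA|] := pselect (acyclic_on E A).
  by apply: leq_trans (acyclic_arcs sE aA A0); rewrite leq_addr.
move=> /existsNP[c /eqP]; rewrite eqbF_neg negbK => cA.
move: (cA) => /and4P[sc cc uc /allP cinA].
case: c sc cc uc cinA cA => // x c sc cc uc cinA cA.
pose y := next (x :: c) x.
have xy : adj E x y by apply: (next_cycle cc); rewrite mem_head.
have xA : x \in A by apply: cinA; rewrite mem_head.
have yA : y \in A by apply: cinA; rewrite mem_next mem_head.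
have yx : y != x by apply: contraTneq xy => ->; rewrite adj_irrefl.
pose E' := E :\ [set x; y].
have adjE' a b : adj E' a b = ([set a; b] != [set x; y]) && adj E a b.
  by rewrite /adj in_setD1.
have sE' : simple_graph E'.
  by apply/forall_inP => e /setD1P[_]; apply: (forall_inP sE).
have aE' : acyclic_on E' A.
  move=> c'; apply/negP => /and4P[sc' cc' uc' c'A].
  have c'E : is_cycle E A c'.
    rewrite /is_cycle sc' uc' c'A !andbT /=.
    by apply: sub_cycle cc' => a b; rewrite adjE' => /andP[].
  (* A cycle surviving the deletion is also a cycle of E, hence has the same edges as [x :: c], the
     deleted one included. *)
  have : [set x; y] \in cycle_edges c'.
    rewrite -(uA _ _ cA c'E); apply/finset.imsetP; exists x => //; exact: mem_head.
  move=> /finset.imsetP[a ac' xyE].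
  have := next_cycle cc' ac'.
  by rewrite adjE' xyE eqxx.
have := acyclic_arcs sE' aE' A0.
suff : arcs E A A <= arcs E' A A + 2 by lia.
rewrite /arcs.
have pt a b : adj E a b <= adj E' a b + ((a == x) && (b == y)) + ((a == y) && (b == x)).
  rewrite adjE'; case: (adj E a b) => //; rewrite andbT.
  have [e|//] := eqVneq [set a; b] [set x; y].
  have : a \in [set x; y] by rewrite -e !inE eqxx.
  have : b \in [set x; y] by rewrite -e !inE eqxx orbT.
  have : x \in [set a; b] by rewrite e !inE eqxx.
  have : y \in [set a; b] by rewrite e !inE eqxx orbT.
  rewrite !inE !(eq_sym x) !(eq_sym y).
  by case: (a == x); case: (a == y); case: (b == x); case: (b == y).
have one u v : u \in A -> v \in A ->
    \sum_(a in A) \sum_(b in A) ((a == u) && (b == v)) = 1.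
  move=> uA' vA; rewrite (big_setD1 u) //= (big_setD1 v) //= !eqxx /=.
  rewrite big1 => [|b]; last by rewrite !inE => /andP[/negPf->].
  rewrite big1 // => a; rewrite !inE => /andP[/negPf-> _].
  by rewrite big1.
apply: leq_trans (_ : _ <= \sum_(a in A) \sum_(b in A)
  (adj E' a b + ((a == x) && (b == y)) + ((a == y) && (b == x)))) _.
  by apply: leq_sum => a _; apply: leq_sum.
under eq_bigr => a _ do rewrite big_split big_split /=.
by rewrite big_split big_split /= !one // -addnA leqnn.
Qed.

End Arcs.

(** * Balls and spheres *)

Section Balls.
Local Open Scope set_scope.
Local Open Scope nat_scope.
Variables (V : finType) (E : {set {set V}}).
Hypothesis cE : connected_graph E.

(** Only lengths below #|V| are searched in [gdist]: a path shortens to one without repetition, and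
    connectedness rules out the default value #|V|. *)
Lemma gdist_leP x y n :
  reflect (exists2 p, path (adj E) x p /\ last x p = y & size p <= n)
          (gdist E x y <= n).
Proof.
rewrite /gdist; set a := (X in find X).
have aP p : path (adj E) x p -> last x p = y -> a (size p).
  by move=> xp lp; apply/existsP; exists (in_tuple p); rewrite /= xp lp eqxx.
have short p : path (adj E) x p -> last x p = y ->
    exists2 k, a k & k <= size p /\ k < #|V|.
  move=> xp; case/shortenP: xp => p' xp' up' p'p lp.
  exists (size p'); first exact: aP.
  split; first by apply: uniq_leq_size => //; case/andP: up'.
  by rewrite -[(size p').+1]/(size (x :: p')) -(card_uniqP up') max_card.
apply: (iffP idP) => [le|[p [xp lp] sp]].
  have /connectP[p xp lp] := forallP (forallP cE x) y.
  have [k ak [_ kV]] := short p xp (esym lp).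
  have hasa : has a (iota 0 #|V|).
    by apply/hasP; exists k => //; rewrite mem_iota.
  have := nth_find 0 hasa; rewrite nth_iota ?add0n; last first.
    by rewrite -[X in _ < X](size_iota 0) -has_find.
  by move=> /existsP[q /andP[xq /eqP lq]]; exists q => //; rewrite size_tuple.
have [k ak [kp kV]] := short p xp lp.
apply: leq_trans sp; apply: leq_trans kp; rewrite leqNgt; apply/negP => kf.
by have := before_find 0 kf; rewrite nth_iota // add0n ak.
Qed.

Definition ball x n : {set V} := [set y | gdist E x y <= n].

Lemma in_ball x n y : (y \in ball x n) = (gdist E x y <= n).
Proof. by rewrite inE. Qed.

Lemma ball0 x : ball x 0 = [set x].
Proof.
apply/setP => y; rewrite !inE; apply/gdist_leP/eqP => [[p [_ <-]]|->].
  by case: p.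
by exists [::].
Qed.

Lemma in_ballS x n y :
  (y \in ball x n.+1) = (y \in ball x n) || [exists z in ball x n, adj E z y].
Proof.
rewrite !in_ball; apply/gdist_leP/idP => [[p [xp lp] sp]|/orP[]].
- case/lastP: p xp lp sp => [_ /= <- _|p z].
    by apply/orP; left; apply/gdist_leP; exists [::].
  rewrite rcons_path last_rcons size_rcons => /andP[xp zy] <- sp.
  apply/orP; right; apply/exists_inP; exists (last x p) => //.
  by rewrite in_ball; apply/gdist_leP; exists p.
- by move=> /gdist_leP[p xp sp]; exists p => //; apply: leqW.
- move=> /exists_inP[z]; rewrite in_ball => /gdist_leP[p [xp lp] sp] zy.
  by exists (rcons p y); rewrite ?rcons_path ?last_rcons ?size_rcons ?lp ?xp.
Qed.

Lemma ball_center x n : x \in ball x n.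
Proof. by rewrite in_ball; apply/gdist_leP; exists [::]. Qed.

Lemma ball_step x n y z : y \in ball x n -> adj E y z -> z \in ball x n.+1.
Proof.
by move=> yn yz; rewrite in_ballS; apply/orP; right; apply/exists_inP; exists y.
Qed.

Lemma ballS x m n : m <= n -> ball x m \subset ball x n.
Proof.
by move=> mn; apply/fintype.subsetP => y; rewrite !in_ball => /leq_trans; apply.
Qed.

Lemma ball_sym x y n : (y \in ball x n) = (x \in ball y n).
Proof.
suff imp a b : b \in ball a n -> a \in ball b n by apply/idP/idP => /imp.
rewrite !in_ball => /gdist_leP[p [ap lp] sp]; apply/gdist_leP.
exists (rev (belast a p)); last by rewrite size_rev size_belast.
split; last by case: p lp {ap sp} => //= c p <-; rewrite // rev_cons last_rcons.
rewrite -lp rev_path; apply: sub_path ap => u v; by rewrite adj_sym.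
Qed.

Lemma arcsT A d : regular_graph E d -> arcs E A finset.setT = d * #|A|.
Proof.
move=> /forallP rE; rewrite mulnC -sum_nat_const; apply: eq_bigr => x _.
rewrite -[in RHS](eqP (rE x)) /deg -sum1_card big_mkcond [RHS]big_mkcond /=.
by apply: eq_bigr => y _; rewrite !inE; case: adj.
Qed.

Lemma card_le_arcs (A B : {set V}) :
  (forall a, a \in A -> exists2 b, b \in B & adj E a b) -> #|A| <= arcs E A B.
Proof.
move=> AB; rewrite -sum1_card; apply: leq_sum => a /AB[b bB ab].
by rewrite (big_setD1 b) //= ab.
Qed.

(** These are the vertices at distance n + 1 from x, not n. *)
Definition sphere x n := ball x n.+1 :\: ball x n.

Lemma sphere_parent x n y : y \in sphere x n ->
  exists2 z, z \in ball x n & adj E y z.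
Proof.
rewrite inE => /andP[yn]; rewrite in_ballS (negPf yn) /= => /exists_inP[z zn zy].
by exists z; rewrite // adj_sym.
Qed.

(** A vertex of a sphere spends at least one of its d arcs on a parent in the smaller ball; the d -
    1 others bound the number of its children. *)
Lemma card_sphere x n d : regular_graph E d ->
  #|sphere x n| <= d * d.-1 ^ n.
Proof.
move=> rE; elim: n => [|n IH].
  apply: (@leq_trans (arcs E (sphere x 0) [set x])).
    by apply: card_le_arcs => a /sphere_parent[b]; rewrite ball0; exists b.
  rewrite arcsC; apply: leq_trans (arcs_sub E (subxx _) (finset.subsetT _)) _.
  by rewrite (arcsT _ rE) cards1.
rewrite expnS mulnCA; apply: leq_trans (leq_mul (leqnn _) IH).
have dis : [disjoint ball x n & sphere x n.+1].
  rewrite disjoint_sym disjoint_subset; apply/fintype.subsetP => y.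
  rewrite !inE => /andP[+ _]; apply: contra => yn; exact: leqW.
have h1 : #|sphere x n| <= arcs E (sphere x n) (ball x n).
  by apply: card_le_arcs => a; apply: sphere_parent.
have h2 : #|sphere x n.+1| <= arcs E (sphere x n) (sphere x n.+1).
  rewrite arcsC; apply: card_le_arcs => a aS; have [z zn az] := sphere_parent aS.
  exists z => //; rewrite inE zn andbT; apply/negP => zn'.
  move: aS; rewrite inE => /andP[+ _]; rewrite (ball_step zn') //.
  by rewrite adj_sym.
have := arcs_sub E (subxx (sphere x n)) (finset.subsetT (ball x n :|: sphere x n.+1)).
rewrite arcsUr // (arcsT _ rE) => h3.
rewrite -subn1 mulnBl mul1n leq_subRL; first by apply: leq_trans h3; rewrite leq_add.
by apply: leq_trans h3; apply: leq_trans h1 _; rewrite leq_addr.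
Qed.

Lemma card_ball x n d : regular_graph E d -> 2 < d ->
  #|ball x n| <= 1 + d * d.-1 ^ n.
Proof.
move=> rE d2; elim: n => [|n IH]; first by rewrite ball0 cards1.
have -> : #|ball x n.+1| = #|ball x n| + #|sphere x n|.
  by rewrite -(cardsID (ball x n)) (finset.setIidPr (ballS _ (leqnSn n))).
have := card_sphere x n rE; rewrite expnS.
(* The ball (without its center) and the sphere are both bounded by d (d - 1)^n, and 2 <= d - 1
   absorbs the sum. *)
have : d * (2 * d.-1 ^ n) <= d * (d.-1 * d.-1 ^ n).
  by rewrite leq_mul2l leq_mul2r -ltnS prednK ?d2 ?orbT //; apply: leq_trans d2.
lia.
Qed.

Lemma gball_ball (R : realType) x (r : R) : (0 <= r)%R ->
  gball E x r = ball x (Num.truncn r).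
Proof.
by move=> r0; apply/setP => y; rewrite !inE truncn_ge_nat.
Qed.

End Balls.

(** * Counting the balls that contain a cycle *)

Section CyclicBalls.
Local Open Scope set_scope.
Local Open Scope nat_scope.
Variables (V : finType) (E : {set {set V}}) (d : nat).
Hypotheses (sE : simple_graph E) (cE : connected_graph E).
Hypothesis rE : regular_graph E d.

(** Uniqueness of cycles concerns their edges, whereas centers are attached to vertex sets; the
    edges determine the vertices. *)
Lemma cycle_support (c : seq V) z :
  (z \in c) = [exists e in cycle_edges c, z \in e].
Proof.
apply/idP/exists_inP => [zc|[e /finset.imsetP[x xc ->]]].
  by exists [set z; next c z]; [apply: imset_f | rewrite !inE eqxx].
by rewrite !inE => /orP[] /eqP-> //; rewrite mem_next.
Qed.

Definition centers n (Z : {set V}) := [set x | Z \subset ball E x n].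

(* For the sets F of centers at radius n and F' at radius n + 1, every neighbour
   of F is in F', and both sets carry at most one cycle, so that
   2 d |F| <= arcs F F + arcs F' F' <= 2 |F| + 2 |F'|. *)
Lemma card_centersS s n Z : (forall x, at_most_one_cycle E (ball E x s)) ->
  Z != finset.set0 -> n < s -> d.-1 * #|centers n Z| <= #|centers n.+1 Z|.
Proof.
move=> us /set0Pn[z zZ] ns.
have inb m : centers m Z \subset ball E z m.
  apply/fintype.subsetP => x; rewrite inE => /fintype.subsetP/(_ z zZ).
  by rewrite ball_sym.
have arcsle m : m <= s -> arcs E (centers m Z) (centers m Z) <= 2 * #|centers m Z|.
  move=> ms; apply: unicyclic_arcs => //; apply: at_most_one_cycleS (us z).
  by apply: fintype.subset_trans (inb m) _; apply: ballS.
have FF : centers n Z \subset centers n.+1 Z.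
  apply/fintype.subsetP => x; rewrite !inE => /fintype.subset_trans; apply.
  exact: ballS.
have step : d * #|centers n Z| <= arcs E (centers n Z) (centers n.+1 Z).
  rewrite -(arcsT _ rE); apply: leq_sum => x; rewrite inE => /fintype.subsetP Zx.
  rewrite [leqRHS]big_mkcond [leqLHS]big_mkcond; apply: leq_sum => y _.
  rewrite finset.in_setT; case: ifPn => //; apply: contraNT; rewrite leqn0 eqb0 negbK.
  move=> xy; rewrite inE; apply/fintype.subsetP => w /Zx.
  by rewrite !(ball_sym cE _ w) => /ball_step; apply.
set F := centers n Z in FF step *; set F' := centers n.+1 Z in FF step *.
have dis : [disjoint F & F' :\: F].
  rewrite disjoint_sym disjoint_subset; apply/fintype.subsetP => y.
  by rewrite !inE => /andP[].
have F'E : F :|: F' :\: F = F'.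
  apply/setP => y; rewrite finset.in_setU finset.in_setD.
  by case: (boolP (y \in F)) => // /(fintype.subsetP FF) ->.
have := arcsUU E dis; have := arcsUr E F dis; rewrite F'E.
have := arcsle n (ltnW ns); have := arcsle n.+1 ns; rewrite -/F -/F'.
move: step; rewrite -subn1 mulnBl; lia.
Qed.

Lemma card_centers s r Z : (forall x, at_most_one_cycle E (ball E x s)) ->
  Z != finset.set0 -> r <= s -> #|centers r Z| * d.-1 ^ (s - r) <= #|centers s Z|.
Proof.
move=> us Z0 rs; rewrite -{2}(subnKC rs).
have : s - r <= s - r by [].
elim: {1 3 4}(s - r) => [|k IH] ks; first by rewrite muln1 addn0.
rewrite addnS expnS mulnCA; apply: leq_trans (leq_mul (leqnn _) (IH (ltnW ks))) _.
apply: (card_centersS us) => //; lia.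
Qed.

(** Every cyclic ball of radius r is counted in [centers r Z] for the vertex set Z of some cycle,
    and [card_centers] passes to radius s. There a vertex belongs to [centers s Z] for at most one
    Z, so the total is at most |V|. *)
Lemma few_cyclic_balls r s : r <= s ->
  (forall x, at_most_one_cycle E (ball E x s)) ->
  #|[set x | `[< ~ acyclic_on E (ball E x r) >]]| * d.-1 ^ (s - r) <= #|V|.
Proof.
move=> rs us.
pose C := [set Z : {set V} | `[< exists2 c, is_cycle E finset.setT c & Z = [set z in c] >]].
have C0 Z : Z \in C -> Z != finset.set0.
  rewrite inE => /asboolP[[|x c] // _ ->].
  by apply/set0Pn; exists x; rewrite !inE eqxx.
apply: (@leq_trans ((\sum_(Z in C) #|centers r Z|) * d.-1 ^ (s - r))).
  rewrite leq_mul2r; apply/orP; right.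
  have -> : \sum_(Z in C) #|centers r Z| = \sum_x \sum_(Z in C) (x \in centers r Z).
    rewrite exchange_big; apply: eq_bigr => Z _ /=.
    by rewrite -sum1_card big_mkcond; apply: eq_bigr => x _; case: (_ \in _).
  rewrite -sum1_card big_mkcond; apply: leq_sum => x _; case: ifPn => //.
  rewrite inE => /asboolP/existsNP[c /eqP]; rewrite eqbF_neg negbK => cB.
  rewrite (big_setD1 [set z in c]) /=; last first.
    rewrite inE; apply/asboolP; exists c => //; exact: is_cycleS cB.
  rewrite inE (_ : _ \subset _) //; apply/fintype.subsetP => z; rewrite inE => zc.
  by case/and4P: cB => _ _ _ /allP; apply.
rewrite big_distrl /=.
apply: (@leq_trans (\sum_(Z in C) #|centers s Z|)).
  by apply: leq_sum => Z /C0 Z0; apply: card_centers.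
have -> : \sum_(Z in C) #|centers s Z| = \sum_x \sum_(Z in C) (x \in centers s Z).
  rewrite exchange_big; apply: eq_bigr => Z _ /=.
  by rewrite -sum1_card big_mkcond; apply: eq_bigr => x _; case: (_ \in _).
rewrite -sum1_card; apply: leq_sum => x _.
rewrite -big_mkcondr sum1_card; apply/card_le1_eqP => Z Z' /=.
rewrite -!topredE /= => /andP[ZC ZF] /andP[ZC' ZF'].
have CP Z0 : Z0 \in C -> exists2 c, is_cycle E finset.setT c & Z0 = [set z in c].
  by rewrite inE => /asboolP.
have [c cc Zc] := CP _ ZC; have [c' cc' Zc'] := CP _ ZC'.
have sub D k : is_cycle E finset.setT k -> D = [set z in k] -> D \subset ball E x s ->
    is_cycle E (ball E x s) k.
  move=> /and4P[k1 k2 k3 _] -> /fintype.subsetP kB; apply/and4P; split=> //.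
  by apply/allP => z zk; apply: kB; rewrite inE.
rewrite inE in ZF; rewrite inE in ZF'.
have /esym ec := us x _ _ (sub _ _ cc Zc ZF) (sub _ _ cc' Zc' ZF').
by rewrite Zc Zc'; apply/setP => z; rewrite !inE !cycle_support ec.
Qed.

End CyclicBalls.

(** * Isomorphism of acyclic balls *)

Section TreeBalls.
Local Open Scope set_scope.
Local Open Scope nat_scope.
Variables (V : finType) (E : {set {set V}}) (d : nat).
Hypotheses (sE : simple_graph E) (cE : connected_graph E).
Hypothesis rE : regular_graph E d.

Lemma ball_sphereU x n : ball E x n :|: sphere E x n = ball E x n.+1.
Proof.
apply/setP => y; rewrite finset.in_setU finset.in_setD.
by case: (boolP (y \in ball E x n)) => // /(fintype.subsetP (ballS E x (leqnSn n))).
Qed.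

Lemma ball_sphere_disj x n : [disjoint ball E x n & sphere E x n].
Proof.
rewrite disjoint_sym disjoint_subset; apply/fintype.subsetP => y.
by rewrite finset.in_setD; case/andP.
Qed.

(** A ball, being connected, has at least as many edges as a tree: every vertex of the next sphere
    brings an edge to its parent. *)
Lemma arcs_ball_ge x n : 2 * #|ball E x n| <= arcs E (ball E x n) (ball E x n) + 2.
Proof.
elim: n => [|n IH]; first by rewrite ball0 // cards1 leq_addl.
have dis := ball_sphere_disj x n.
rewrite -ball_sphereU arcsUU // cardsU (disjoint_setI0 dis) cards0.
have : #|sphere E x n| <= arcs E (sphere E x n) (ball E x n).
  by apply: card_le_arcs => a; apply: sphere_parent.
rewrite (arcsC E (sphere E x n)). lia.
Qed.

(* Counting arcs: the connected ball of radius n + 1 has as few arcs as a tree, so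
   each vertex of the sphere has one arc into the ball and none along the sphere. *)
Lemma tree_sphere x n : acyclic_on E (ball E x n.+1) ->
  (forall b a a', b \in sphere E x n -> a \in ball E x n -> a' \in ball E x n ->
     adj E b a -> adj E b a' -> a = a') /\
  (forall b b', b \in sphere E x n -> b' \in sphere E x n -> adj E b b' = false).
Proof.
move=> aB.
have B0 : ball E x n.+1 != finset.set0 by apply/set0Pn; exists x; apply: ball_center.
have := acyclic_arcs sE aB B0.
have dis := ball_sphere_disj x n.
rewrite -ball_sphereU arcsUU // cardsU (disjoint_setI0 dis) cards0.
have := arcs_ball_ge x n; rewrite (arcsC E (ball E x n) (sphere E x n)).
set S := sphere E x n; set B := ball E x n => h1 h2.
have degS b : b \in S -> 1 <= \sum_(a in B) adj E b a.
  by move=> /(sphere_parent cE)[a aB' ba]; rewrite (big_setD1 a) //= ba.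
have SB : #|S| <= arcs E S B by rewrite -sum1_card; apply: leq_sum.
split=> [b a a' bS aB1 aB2 ba ba'|b b' bS bS'].
  apply/eqP/negPn/negP => aa'.
  have : arcs E S B <= #|S| by lia.
  rewrite /arcs (big_setD1 b) //= leqNgt => /negP; apply.
  rewrite (cardsD1 b) bS; apply: (@leq_add 2 #|S :\ b|).
    have a'B : a' \in B :\ a by rewrite finset.in_setD1 eq_sym aa'.
    by rewrite (big_setD1 a) //= (big_setD1 a') //= ba ba'.
  by rewrite -sum1_card; apply: leq_sum => c; rewrite inE => /andP[_ /degS].
apply/negP => bb'.
have : arcs E S S <= 0 by lia.
by rewrite /arcs (big_setD1 b) //= (big_setD1 b') //= bb'.
Qed.

(** All neighbours of a lie in the ball or the next sphere, so regularity deduces the number of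
    children from the adjacencies inside the ball, which an isomorphism preserves. *)
Lemma card_children x n a : a \in ball E x n ->
  #|[set b in sphere E x n | adj E a b]| + \sum_(b in ball E x n) adj E a b = d.
Proof.
move=> aB; rewrite -(eqP (forallP rE a)) /deg.
rewrite -[X in _ = X](cardsID (ball E x n)) addnC; congr (_ + _).
  rewrite -sum1_card big_mkcond [RHS]big_mkcond; apply: eq_bigr => y _ /=.
  by rewrite finset.in_setI [y \in [set _ | _]]inE andbC; case: (y \in _); case: adj.
apply: eq_card => y; rewrite !inE -!in_ball.
case: (boolP (y \in ball E x n)) => //= yB; case: (boolP (adj E a y)); rewrite ?andbF // => ay.
by rewrite (ball_step cE aB).
Qed.

(** An isomorphism f extends from radius n to n + 1 by matching the children of a with those of f a,
    equally many by [card_children]. By [tree_sphere] no other adjacency has to be preserved: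
    parents are unique and the sphere has no inner edge. *)
Lemma tree_balls_equiv x y r :
  acyclic_on E (ball E x r) -> acyclic_on E (ball E y r) ->
  pointed_equiv E x (ball E x r) y (ball E y r).
Proof.
move=> ax ay; have : r <= r by [].
elim: {1 3 4}r => [|n IH] nr.
  exists (fun=> y); rewrite !ball0 //; split=> //.
  - by move=> a b /set1P-> /set1P->.
  - by rewrite finset.imset_set1.
  - by move=> a b /set1P-> /set1P->; rewrite !adj_irrefl.
have [f [finj fim fx fadj]] := IH (ltnW nr).
have [ux nx] := tree_sphere (acyclic_onS (ballS E x nr) ax).
have [uy ny] := tree_sphere (acyclic_onS (ballS E y nr) ay).
have spx := @sphere_parent _ _ cE x n; have spy := @sphere_parent _ _ cE y n.
have cx := @card_children x n; have cy := @card_children y n.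
have disx := ball_sphere_disj x n; have disy := ball_sphere_disj y n.
rewrite -!ball_sphereU.
set B := ball E x n in finj fim fadj ux nx spx cx disx *.
set B' := ball E y n in fim uy ny spy cy disy *.
set S := sphere E x n in ux nx spx cx disx *.
set S' := sphere E y n in uy ny spy cy disy *.
have fB a : a \in B -> f a \in B' by move=> aB; rewrite -fim; apply: imset_f.
have SB b : b \in S -> b \notin B by move=> bS; rewrite (disjointFl disx bS).
have SB' b : b \in S' -> b \notin B' by move=> bS; rewrite (disjointFl disy bS).
pose ch a := [set b in S | adj E a b]; pose ch' a := [set b in S' | adj E a b].
have chE a : a \in B -> #|ch' (f a)| = #|ch a|.
  move=> aB; have := cx a aB; have := cy _ (fB a aB); rewrite -/(ch a) -/(ch' (f a)).
  suff -> : \sum_(b in B') adj E (f a) b = \sum_(b in B) adj E a b by lia.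
  by rewrite -fim big_imset //=; apply: eq_bigr => b bB; rewrite fadj.
(* The default x is never reached for b in the sphere. *)
pose par b := odflt x [pick a in B | adj E b a].
have parP b : b \in S -> par b \in B /\ adj E b (par b).
  move=> /spx[a aB ba]; rewrite /par; case: pickP => [c /andP[] //|/(_ a)].
  by rewrite /= aB ba.
(* The i-th child of a goes to the i-th child of f a, in the order of [enum]; the default y is never
   reached on S. *)
pose g b := if b \in B then f b else
  nth y (enum (ch' (f (par b)))) (index b (enum (ch (par b)))).
have gB b : b \in B -> g b = f b by rewrite /g => ->.
have idx b : b \in S -> b \in enum (ch (par b)).
  by move=> bS; rewrite mem_enum inE bS; have [_ ] := parP b bS; rewrite adj_sym.
have sz b : b \in S -> index b (enum (ch (par b))) < size (enum (ch' (f (par b)))).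
  move=> bS; have [pB _] := parP b bS.
  by rewrite -cardE chE // cardE index_mem idx.
have gS b : b \in S -> g b \in S' /\ adj E (g b) (f (par b)).
  move=> bS; rewrite /g (negPf (SB b bS)).
  have := mem_nth y (sz b bS); rewrite mem_enum inE => /andP[-> ].
  by rewrite adj_sym.
have gpar a b : b \in S -> a \in B -> adj E (g b) (f a) -> a = par b.
  move=> bS aB ga; have [gbS gp] := gS b bS; have [pB _] := parP b bS.
  by apply: finj => //; apply: uy gbS (fB _ aB) (fB _ pB) ga gp.
exists g; split.
- move=> a b /finset.setUP[aB|aS] /finset.setUP[bB|bS] gab.
  + by apply: finj => //; rewrite -!gB.
  + have [/SB' + _] := gS b bS; by rewrite -gab gB // fB.
  + have [/SB' + _] := gS a aS; by rewrite gab gB // fB.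
  have pab : par a = par b.
    have [pa _] := parP a aS; have [_ ga] := gS a aS.
    by apply: gpar => //; rewrite -gab.
  move: gab; rewrite /g (negPf (SB a aS)) (negPf (SB b bS)) pab => /eqP.
  have sa := sz a aS; rewrite pab in sa.
  rewrite nth_uniq ?enum_uniq ?sz // => /eqP iab.
  have ia := idx a aS; rewrite pab in ia.
  by rewrite -(nth_index x ia) iab nth_index ?idx.
- apply/setP => c; apply/finset.imsetP/idP => [[b /finset.setUP[bB|bS] ->]|/finset.setUP[]].
  + by rewrite finset.in_setU gB // fB.
  + by rewrite finset.in_setU; have [-> _] := gS b bS; rewrite orbT.
  + rewrite -fim => /finset.imsetP[a aB ->]; exists a; first by rewrite finset.in_setU aB.
    by rewrite gB.
  move=> cS; have [a' + ca'] := spy c cS; rewrite -fim => /finset.imsetP[a aB a'E].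
  have cch : c \in enum (ch' (f a)) by rewrite mem_enum inE cS adj_sym -a'E.
  have si : index c (enum (ch' (f a))) < size (enum (ch a)).
    by rewrite -cardE -chE // cardE index_mem.
  pose b := nth x (enum (ch a)) (index c (enum (ch' (f a)))).
  have : b \in ch a by rewrite -mem_enum mem_nth.
  rewrite inE => /andP[bS ab]; have [pB bp] := parP b bS.
  have pa : par b = a by apply: ux bS pB aB bp _; rewrite adj_sym.
  exists b; first by rewrite finset.in_setU bS orbT.
  by rewrite /g (negPf (SB b bS)) pa index_uniq ?enum_uniq // nth_index.
- by rewrite gB ?fx // ball_center.
have mix a b : a \in B -> b \in S -> adj E (g b) (g a) = adj E b a.
  move=> aB bS; rewrite (gB a) //; have [pB bp] := parP b bS; have [gbS gp] := gS b bS.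
  apply/idP/idP => [ga|ba]; first by rewrite (gpar a b bS aB ga).
  by rewrite (ux b a (par b) bS aB pB ba bp).
move=> a b /finset.setUP[aB|aS] /finset.setUP[bB|bS].
- by rewrite !gB // fadj.
- by rewrite adj_sym mix // adj_sym.
- exact: mix.
by rewrite (nx a b) // (ny (g a) (g b)) //; [have [] := gS a aS | have [] := gS b bS].
Qed.

End TreeBalls.

(** * Spectral gap *)

Section Rayleigh.
Variables (R : realType) (n : nat).
Implicit Types (K : 'M[R]_n) (u v h : 'rV[R]_n).

Definition quad K v : R := (v *m K *m v^T) 0 0.
Definition sqn v : R := (v *m v^T) 0 0.

Lemma sqnE v : sqn v = \sum_i v 0 i ^+ 2.
Proof. by rewrite /sqn mxE; apply: eq_bigr => i _; rewrite mxE expr2. Qed.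

Lemma sqn_ge0 v : 0 <= sqn v.
Proof. by rewrite sqnE; apply: sumr_ge0 => i _; apply: sqr_ge0. Qed.

Lemma sqn_eq0 v : sqn v = 0 -> v = 0.
Proof.
rewrite sqnE => /eqP; rewrite psumr_eq0 => [/allP v0|i _]; last exact: sqr_ge0.
by apply/rowP => i; rewrite mxE; have := v0 i; rewrite mem_index_enum sqrf_eq0 => /(_ isT)/eqP.
Qed.

Lemma quadZ K a v : quad K (a *: v) = a ^+ 2 * quad K v.
Proof. by rewrite /quad -scalemxAl -scalemxAl linearZ /= -scalemxAr !mxE expr2 mulrA. Qed.

Lemma sqnZ a v : sqn (a *: v) = a ^+ 2 * sqn v.
Proof. by rewrite /sqn -scalemxAl linearZ /= -scalemxAr !mxE expr2 mulrA. Qed.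

Lemma continuous_sum_ord (T : topologicalType) k (F : 'I_k -> T -> R) :
  (forall i, continuous (F i)) -> continuous (fun z => \sum_i F i z).
Proof.
elim: k F => [|k IH] F cF x.
  rewrite (_ : (fun _ => _) = cst 0); first exact: cst_continuous.
  by apply/funext => z; rewrite big_ord0.
rewrite (_ : (fun _ => _) = (F ord0 \+ (fun z => \sum_i F (lift ord0 i) z))).
  by apply: cvgD; [exact: cF|apply: IH => i; exact: cF].
by apply/funext => z; rewrite big_ord_recl.
Qed.

Lemma continuous_coordM (T : topologicalType) (f g : T -> R) :
  continuous f -> continuous g -> continuous (fun z => f z * g z).
Proof. by move=> cf cg x; apply: cvgM; [exact: cf|exact: cg]. Qed.

Lemma continuous_mulmx m (M : 'M[R]_(n, m)) j :
  continuous (fun v : 'rV[R]_n => (v *m M) 0 j).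
Proof.
rewrite (_ : (fun _ => _) = (fun v : 'rV[R]_n => \sum_k v 0 k * M k j)); last first.
  by apply/funext => v; rewrite mxE.
apply: continuous_sum_ord => k; apply: continuous_coordM; first exact: coord_continuous.
by move=> v; exact: cst_continuous.
Qed.

Lemma continuous_quad K : continuous (quad K).
Proof.
rewrite (_ : quad K = (fun v : 'rV[R]_n => \sum_k (v *m K) 0 k * v 0 k)); last first.
  by apply/funext => v; rewrite /quad mxE; apply: eq_bigr => k _; rewrite [_^T _ _]mxE.
apply: continuous_sum_ord => k; apply: continuous_coordM; last exact: coord_continuous.
exact: continuous_mulmx.
Qed.

Lemma continuous_sqn : continuous sqn.
Proof.
rewrite (_ : sqn = quad 1%:M); first exact: continuous_quad.
by apply/funext => v; rewrite /quad mulmx1.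
Qed.

(* A minimizer v of the quadratic form on the unit sphere of the orthogonal
   complement of c is an eigenvector: for h = v K - m v, the inequality along the
   line v + t h forces h = 0. *)
Lemma rayleigh_min K (c : 'cV[R]_n) : K^T = K -> K *m c = 0 ->
  (exists2 v : 'rV[R]_n, v *m c = 0 & v != 0) ->
  exists v m, [/\ v != 0, v *m c = 0, v *m K = m *: v &
    forall u, u *m c = 0 -> m * sqn u <= quad K u].
Proof.
move=> KT Kc [w wc w0].
pose S := [set v : 'rV[R]_n | (v *m c) 0 0 = 0 /\ sqn v = 1]%classic.
have Sc v : (v *m c) 0 0 = 0 -> v *m c = 0.
  by move=> e; apply/matrixP => i j; rewrite !ord1 e mxE.
have nrm u : u != 0 -> 0 < sqn u.
  by move=> u0; rewrite lt_neqAle sqn_ge0 andbT eq_sym; apply: contraNneq u0 => /sqn_eq0 ->.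
have nrmS u : u *m c = 0 -> u != 0 -> S ((Num.sqrt (sqn u))^-1 *: u).
  move=> uc u0; split; first by rewrite -scalemxAl uc scaler0 mxE.
  by rewrite sqnZ exprVn sqr_sqrtr ?sqn_ge0 // mulVf // gt_eqF ?nrm.
have cS : compact S.
  apply: bounded_closed_compact; last first.
    rewrite (_ : S = [set v | (v *m c) 0 0 = 0] `&` [set v | sqn v = 1])%classic //.
    apply: closedI.
      have := proj1 (continuous_closedP _) (@continuous_mulmx _ c 0) _ (@closed_eq _ (0 : R)).
      exact.
    exact: (proj1 (continuous_closedP _) continuous_sqn _ (@closed_eq _ (1 : R))).
  (* The matrix norm is the largest absolute coordinate, at most 1 when the squares sum to 1. *)
  exists 1; split; first exact: num_real.
  move=> M M1 v [_ v1]; apply: le_trans (ltW M1).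
  rewrite [leLHS]/Num.Def.normr /= mx_normrE; apply/bigmax_leP; split => //.
  move=> [i j] _ /=; rewrite ord1 -(@expr_le1 _ 2) ?normr_ge0 // real_normK ?num_real //.
  rewrite -v1 sqnE (bigD1 j) //= lerDl; apply: sumr_ge0 => k _; exact: sqr_ge0.
have S0 : (S !=set0)%classic by exists ((Num.sqrt (sqn w))^-1 *: w); exact: nrmS.
have [|v vS vmin] := compact_EVT_min S0 cS (f := quad K).
  by apply: continuous_subspaceT; exact: continuous_quad.
rewrite inE in vS; case: vS => /Sc vc v1.
pose m := quad K v.
have ray u : u *m c = 0 -> m * sqn u <= quad K u.
  move=> uc; have [->|u0] := eqVneq u 0.
    by rewrite /sqn /quad !mul0mx mxE mulr0.
  have := vmin _ (mem_set (nrmS u uc u0)).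
  rewrite quadZ exprVn sqr_sqrtr ?sqn_ge0 // -/m.
  by rewrite ler_pdivlMl ?nrm // mulrC.
exists v, m; split=> //.
  by apply/negP => /eqP v0; move: v1 => /eqP; rewrite v0 /sqn mul0mx mxE eq_sym oner_eq0.
have [h hE] : exists h, h = v *m K - m *: v by exists (v *m K - m *: v).
have hc : h *m c = 0.
  by rewrite hE mulmxBl -mulmxA Kc mulmx0 -scalemxAl vc scaler0 subrr.
have [M ME] : exists M, M = K - m%:M by exists (K - m%:M).
have vM : v *m M = h by rewrite ME hE mulmxBr mul_mx_scalar.
have quadM u : quad M u = quad K u - m * sqn u.
  by rewrite ME /quad /sqn mulmxBr mulmxBl mul_mx_scalar -scalemxAl !mxE.
have MT : M^T = M by rewrite ME linearB /= KT tr_scalar_mx.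
have hv : (h *m M *m v^T) 0 0 = sqn h.
  by rewrite /sqn (_ : h^T = M *m v^T) ?mulmxA // -vM trmx_mul MT.
have Mv : quad M v = 0 by rewrite quadM v1 mulr1 subrr.
have Mt t : quad M (v + t *: h) = 2 * t * sqn h + t ^+ 2 * quad M h.
  move: Mv hv; rewrite /quad /sqn vM => Mv hv.
  have -> : (v + t *: h)^T = v^T + t *: h^T by rewrite linearD linearZ.
  rewrite mulmxDl mulmxDr !mulmxDl vM -!scalemxAl -!scalemxAr.
  have D (A B : 'M[R]_1) : (A + B) 0 0 = A 0 0 + B 0 0 by rewrite mxE.
  have Z a (A : 'M[R]_1) : (a *: A) 0 0 = a * A 0 0 by rewrite mxE.
  rewrite !(D, Z) Mv hv; ring.
have ge0 t : 0 <= 2 * t * sqn h + t ^+ 2 * quad M h.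
  rewrite -Mt quadM subr_ge0 ray // mulmxDl vc -scalemxAl hc scaler0 addr0 //.
have Mh : 0 <= quad M h by rewrite quadM subr_ge0 ray.
suff /sqn_eq0 /eqP : sqn h = 0 by rewrite hE subr_eq0 => /eqP.
apply/eqP; rewrite eq_le sqn_ge0 andbT leNgt; apply/negP => h0.
(* At this t the linear term beats the quadratic one; the added 1 keeps the denominator positive
   even if [quad M h] is 0. *)
have := ge0 (- (sqn h / (quad M h + 1))).
have -> : 2 * (- (sqn h / (quad M h + 1))) * sqn h +
    (- (sqn h / (quad M h + 1))) ^+ 2 * quad M h =
    - (sqn h ^+ 2 * (quad M h + 2)) / (quad M h + 1) ^+ 2.
  by field; rewrite gt_eqF // ltr_wpDl.
rewrite mulNr oppr_ge0 leNgt => /negP; apply.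
by rewrite divr_gt0 ?mulr_gt0 ?exprn_gt0 // ltr_wpDl.
Qed.

End Rayleigh.

(** * Dirichlet form and Poincare inequality *)

Section GraphSpectrum.
Variables (R : realType) (V : finType) (E : {set {set V}}) (d : nat).
Hypotheses (cE : connected_graph E) (rE : regular_graph E d) (d_gt0 : (0 < d)%N).
Implicit Types (f g : V -> R) (x y : V).

Definition avg f x : R := (\sum_y (adj E x y)%:R * f y) / d%:R.

(** Dirichlet form of the simple random walk, for the counting measure. *)
Definition energy f : R := \sum_x f x * (f x - avg f x).

Let d0 : d%:R != 0 :> R. Proof. by rewrite pnatr_eq0 -lt0n. Qed.

Lemma degE x : deg E x = d.
Proof. exact/eqP/(forallP rE). Qed.

Lemma sum_adj x : \sum_y (adj E x y)%:R = d%:R :> R.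
Proof.
rewrite -(degE x) /deg -sum1_card natr_sum big_mkcond [RHS]big_mkcond /=.
by apply: eq_bigr => y _; rewrite !inE; case: adj.
Qed.

Lemma avg_sym f g : \sum_x f x * avg g x = \sum_x avg f x * g x.
Proof.
under eq_bigr => x _ do rewrite mulrA mulr_sumr.
under [RHS]eq_bigr => x _ do rewrite mulrAC mulr_suml.
rewrite -!mulr_suml exchange_big /=; congr (_ / _).
apply: eq_bigr => x _; apply: eq_bigr => y _.
by rewrite (adj_sym E x y); ring.
Qed.

Lemma avg_cst a x : avg (fun=> a) x = a.
Proof. by rewrite /avg -mulr_suml sum_adj mulrAC divff // mul1r. Qed.

Lemma sum_avg f : \sum_x avg f x = \sum_x f x.
Proof.
transitivity (\sum_x 1 * avg f x); first by apply: eq_bigr => x _; rewrite mul1r.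
by rewrite (avg_sym (fun=> 1)); apply: eq_bigr => x _; rewrite avg_cst mul1r.
Qed.

(** The difference of the two sides is the variance of f after one step from x. *)
Lemma avg_sqr_le f x : avg f x ^+ 2 <= avg (fun y => f y ^+ 2) x.
Proof.
have : 0 <= avg (fun y => (f y - avg f x) ^+ 2) x.
  apply: divr_ge0 => //; apply: sumr_ge0 => y _.
  by apply: mulr_ge0 => //; apply: sqr_ge0.
suff -> : avg (fun y => (f y - avg f x) ^+ 2) x =
    avg (fun y => f y ^+ 2) x - avg f x ^+ 2 by rewrite subr_ge0.
set m := avg f x; rewrite {1}/avg.
have -> : \sum_y (adj E x y)%:R * (f y - m) ^+ 2 =
    \sum_y (adj E x y)%:R * f y ^+ 2 - 2 * m * (\sum_y (adj E x y)%:R * f y)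
      + m ^+ 2 * \sum_y (adj E x y)%:R.
  rewrite !mulr_sumr -sumrB -big_split /=.
  by apply: eq_bigr => y _; ring.
have -> : \sum_y (adj E x y)%:R * f y = m * d%:R by rewrite /m /avg divfK.
by rewrite sum_adj /avg; field.
Qed.

Lemma sum_avg_sqr f : \sum_x avg f x ^+ 2 <= \sum_x f x ^+ 2.
Proof.
by rewrite -[leRHS]sum_avg; apply: ler_sum => x _; apply: avg_sqr_le.
Qed.

(** The form as a sum over edges shows that it is nonnegative and, by connectedness, that it
    vanishes on constants only. *)
Lemma energyE f :
  energy f = (2 * d%:R)^-1 * \sum_x \sum_y (adj E x y)%:R * (f x - f y) ^+ 2.
Proof.
have davg g x : d%:R * avg g x = \sum_y (adj E x y)%:R * g y by rewrite mulrC divfK.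
have e x : \sum_y (adj E x y)%:R * (f x - f y) ^+ 2 =
    d%:R * (f x ^+ 2 + avg (fun y => f y ^+ 2) x - 2 * (f x * avg f x)).
  have -> : d%:R * (f x ^+ 2 + avg (fun y => f y ^+ 2) x - 2 * (f x * avg f x)) =
    f x ^+ 2 * d%:R + d%:R * avg (fun y => f y ^+ 2) x - 2 * f x * (d%:R * avg f x) by ring.
  rewrite -{1}(sum_adj x) !davg !mulr_sumr -big_split -sumrB /=.
  by apply: eq_bigr => y _; ring.
under eq_bigr => x _ do rewrite e.
rewrite -mulr_sumr sumrB big_split /= sum_avg -mulr_sumr /energy.
under [LHS]eq_bigr => x _ do rewrite mulrBr -expr2.
by rewrite sumrB; field.
Qed.

Lemma energy_ge0 f : 0 <= energy f.
Proof.
rewrite energyE mulr_ge0 // ?invr_ge0 ?mulr_ge0 //.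
by apply: sumr_ge0 => x _; apply: sumr_ge0 => y _; rewrite mulr_ge0 ?sqr_ge0.
Qed.

Lemma energy_eq0 f : energy f = 0 -> forall x y, f x = f y.
Proof.
rewrite energyE => /eqP; rewrite mulf_eq0 invr_eq0 mulf_eq0 pnatr_eq0 (negPf d0) /=.
rewrite psumr_eq0 => [/allP e0|x _]; last first.
  by apply: sumr_ge0 => y _; rewrite mulr_ge0 ?sqr_ge0.
have fadj x y : adj E x y -> f x = f y.
  move=> xy; have := e0 x; rewrite mem_index_enum => /(_ isT).
  rewrite /= psumr_eq0 => [/allP/(_ y)|z _]; last by rewrite mulr_ge0 ?sqr_ge0.
  by rewrite mem_index_enum xy mul1r sqrf_eq0 subr_eq0 => /(_ isT)/eqP.
move=> x y; have /connectP[p xp ->] := forallP (forallP cE x) y.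
elim: p x xp => //= z p IH x /andP[xz zp].
by rewrite (fadj _ _ xz); exact: IH.
Qed.

Let vec f : 'rV[R]_#|V| := \row_i f (enum_val i).

Let vec_rank (v : 'rV[R]_#|V|) : v = vec (fun x => v 0 (enum_rank x)).
Proof. by apply/rowP => i; rewrite mxE enum_valK. Qed.

Let sum_enum f : \sum_(i < #|V|) f (enum_val i) = \sum_x f x.
Proof. by rewrite (@big_enum_val _ _ _ _ predT f). Qed.

Let K : 'M[R]_#|V| := - srw_generator R E.

(** Eigenvectors are row vectors, multiplied by the matrix on the right; the symmetry of adjacency
    and the constant degree turn this into f - avg f. *)
Let vecK f : vec f *m K = vec (fun x => f x - avg f x).
Proof.
apply/rowP => j; rewrite !mxE.
under eq_bigr => i _ do rewrite !mxE degE.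
under eq_bigr => i _ do rewrite -(inj_eq enum_val_inj).
rewrite (sum_enum (fun x => f x * - ((adj E x (enum_val j))%:R / d%:R - (x == enum_val j)%:R))).
set z := enum_val j.
under eq_bigr => x _ do rewrite opprB mulrBr.
rewrite sumrB (bigD1 z) //= eqxx mulr1 big1 ?addr0 => [|x /negPf->]; last by rewrite mulr0.
congr (_ - _); rewrite /avg mulr_suml; apply: eq_bigr => x _.
by rewrite (adj_sym E z x); ring.
Qed.

Let quad_vec f : quad K (vec f) = energy f.
Proof.
rewrite /quad vecK mxE /energy -(sum_enum (fun x => f x * (f x - avg f x))).
by apply: eq_bigr => i _; rewrite !mxE mulrC.
Qed.

Let sqn_vec f : sqn (vec f) = \sum_x f x ^+ 2.
Proof.
by rewrite sqnE -(sum_enum (fun x => f x ^+ 2)); apply: eq_bigr => i _; rewrite mxE.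
Qed.

Let c : 'cV[R]_#|V| := const_mx 1.

Let vec_c f : (vec f *m c = 0) <-> (\sum_x f x = 0).
Proof.
have e : (vec f *m c) 0 0 = \sum_x f x.
  by rewrite mxE -sum_enum; apply: eq_bigr => i _; rewrite !mxE mulr1.
split=> [z|z]; first by rewrite -e z mxE.
by apply/matrixP => i j; rewrite !ord1 e z mxE.
Qed.

(** By [rayleigh_min] with c constant, the least ratio m of energy to squared norm over functions of
    sum 0 is an eigenvalue. If m were 0, its eigenvector would be constant with sum 0, hence null.
    So m is in the set whose infimum is the gap. *)
Lemma poincare f : \sum_x f x = 0 ->
  spectral_gap R E * \sum_x f x ^+ 2 <= energy f.
Proof.
move=> f0; have [vf0|vf0] := eqVneq (vec f) 0.
  by rewrite -sqn_vec vf0 /sqn mul0mx mxE mulr0 energy_ge0.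
have KT : K^T = K.
  rewrite /K linearN /=; congr (- _); apply/matrixP => i j.
  by rewrite !mxE !degE adj_sym eq_sym.
have Kc : K *m c = 0.
  rewrite -[K *m c]trmxK trmx_mul KT.
  have -> : c^T = vec (fun=> 1) by apply/rowP => i; rewrite !mxE.
  rewrite vecK; have -> : vec (fun x => 1 - avg (fun=> 1) x) = 0.
    by apply/rowP => i; rewrite !mxE avg_cst subrr.
  by rewrite trmx0.
have [|v [m [v0 vc vK ray]]] := rayleigh_min KT Kc.
  by exists (vec f) => //; apply/vec_c.
apply: (@le_trans _ _ (m * \sum_x f x ^+ 2)); last first.
  by rewrite -sqn_vec -quad_vec ray //; apply/vec_c.
apply: ler_wpM2r; first by apply: sumr_ge0 => x _; apply: sqr_ge0.
have quadE (u : 'rV_#|V|) a : u *m K = a *: u -> quad K u = a * sqn u.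
  by move=> uK; rewrite /quad uK -scalemxAl mxE.
have sqn_gt0 (u : 'rV[R]_#|V|) : u != 0 -> 0 < sqn u.
  by move=> u0; rewrite lt_neqAle sqn_ge0 andbT eq_sym; apply: contraNneq u0 => /sqn_eq0 ->.
apply: ge_inf.
  (* An infimum needs a lower bound: eigenvalues are nonnegative since the energy is. *)
  exists 0 => a [/eigenvalueP[u uK u0] _].
  rewrite -(pmulr_lge0 _ (sqn_gt0 u u0)) -(quadE _ _ uK) (vec_rank u) quad_vec.
  exact: energy_ge0.
split; first by apply/eigenvalueP; exists v.
apply/negP => /eqP m0; move: v0 => /negP; apply; apply/eqP.
have := quadE _ _ vK; rewrite m0 mul0r (vec_rank v) quad_vec => /energy_eq0 gc.
move: vc; rewrite {1}(vec_rank v) => /vec_c gs.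
rewrite (vec_rank v); apply/rowP => i; rewrite !mxE.
have := gs; rewrite (eq_bigr (fun=> v 0 (enum_rank (enum_val i)))) => [|x _]; last exact: gc.
rewrite sumr_const => /eqP; rewrite mulrn_eq0 => /orP[|/eqP]; last by rewrite !enum_valK.
by rewrite -leqn0 leqNgt => /negP[]; exact: leq_ltn_trans (ltn_ord i).
Qed.

End GraphSpectrum.

(** * Hitting and mixing of the lazy walk *)

Section LazyWalk.
Variables (R : realType) (V : finType) (E : {set {set V}}) (d : nat).
Hypotheses (cE : connected_graph E) (rE : regular_graph E d) (d_gt0 : (0 < d)%N).
Implicit Types (f g : V -> R) (x y : V).

Definition lazy_avg f x : R := \sum_z lazy_step R E x z * f z.

Let d0 : d%:R != 0 :> R. Proof. by rewrite pnatr_eq0 -lt0n. Qed.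

Lemma lazy_avgE f x : lazy_avg f x = (f x + avg E d f x) / 2.
Proof.
rewrite /lazy_avg /lazy_step; under eq_bigr => z _ do rewrite mulrDl.
rewrite big_split /= (bigD1 x) //= eqxx big1 ?addr0 => [|z].
  rewrite [RHS]mulrDl; congr (_ + _); first by rewrite mul1r mulrC.
  rewrite /avg !mulr_suml; apply: eq_bigr => z _; rewrite (degE rE).
  by field.
by rewrite eq_sym => /negPf->; rewrite !mul0r.
Qed.

Lemma lazy_step_ge0 x y : 0 <= lazy_step R E x y.
Proof. by apply: addr_ge0; apply: divr_ge0 => //; apply: mulr_ge0. Qed.

Lemma lazy_avg_cst a x : lazy_avg (fun=> a) x = a.
Proof. by rewrite lazy_avgE (avg_cst rE) //; field. Qed.

Lemma lazy_avg_ge0 f x : (forall y, 0 <= f y) -> 0 <= lazy_avg f x.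
Proof. by move=> f0; apply: sumr_ge0 => y _; rewrite mulr_ge0 // lazy_step_ge0. Qed.

Lemma lazy_avg_le f g x : (forall y, f y <= g y) -> lazy_avg f x <= lazy_avg g x.
Proof. by move=> fg; apply: ler_sum => y _; rewrite ler_wpM2l // lazy_step_ge0. Qed.

Lemma lazy_avgB f a x : lazy_avg (fun y => f y - a) x = lazy_avg f x - a.
Proof.
rewrite -[in RHS](lazy_avg_cst a x) /lazy_avg -sumrB.
by apply: eq_bigr => y _; rewrite mulrBr.
Qed.

Lemma sum_lazy_avg f : \sum_x lazy_avg f x = \sum_x f x.
Proof.
under eq_bigr => x _ do rewrite lazy_avgE.
by rewrite -mulr_suml big_split /= (sum_avg rE) //; field.
Qed.

(** The k-step transition probability from x to y, seen as a function of the starting point. *)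
Definition kern k x y : R := iter k lazy_avg (fun z => (z == y)%:R) x.

Lemma kernS k x y : kern k.+1 x y = lazy_avg (kern k ^~ y) x.
Proof. by []. Qed.

Lemma kern_ge0 k x y : 0 <= kern k x y.
Proof. by elim: k x => //= k IH x; apply: lazy_avg_ge0. Qed.

Lemma kern_far k x y : x \notin ball E y k -> kern k x y = 0.
Proof.
elim: k x => [|k IH] x; first by rewrite ball0 // inE /kern /= => /negPf->.
move=> xk; rewrite kernS /lazy_avg big1 // => z _.
have [zk|/IH->] := boolP (z \in ball E y k); last by rewrite mulr0.
rewrite /lazy_step; have [xz|_] := eqVneq x z.
  by move: xk; rewrite xz (fintype.subsetP (ballS E y (leqnSn k)) z zk).
case: (boolP (adj E x z)) => [xz|_]; last by rewrite !mul0r addr0 mul0r.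
by move: xk; rewrite (ball_step cE zk) // adj_sym.
Qed.

Section Decay.
Variable gamma : R.
Hypotheses (gamma_gt0 : 0 < gamma) (gamma_le1 : gamma <= 1).
Hypothesis gap : gamma <= spectral_gap R E.

Let rate : R := Num.sqrt (1 - gamma / 2).

(** In the square of (f + avg f) / 2, the inner product of f and avg f is at most 1 - gamma times
    the squared norm by [poincare], and [avg] is a contraction: the constant is (1 + 2 (1 - gamma) +
    1) / 4. *)
Lemma lazy_avg_sqr f : \sum_x f x = 0 ->
  \sum_x lazy_avg f x ^+ 2 <= (1 - gamma / 2) * \sum_x f x ^+ 2.
Proof.
move=> f0.
have h1 : gamma * \sum_x f x ^+ 2 <= energy E d f.
  apply: le_trans (poincare cE rE d_gt0 f0).
  by rewrite ler_wpM2r // sumr_ge0 // => x _; apply: sqr_ge0.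
have h2 := sum_avg_sqr rE d_gt0 f.
have e : energy E d f = \sum_x f x ^+ 2 - \sum_x f x * avg E d f x.
  by rewrite /energy -sumrB; apply: eq_bigr => x _; rewrite mulrBr expr2.
have -> : \sum_x lazy_avg f x ^+ 2 =
    (\sum_x f x ^+ 2 + 2 * (\sum_x f x * avg E d f x) + \sum_x avg E d f x ^+ 2) / 4.
  rewrite mulr_sumr -!big_split /= mulr_suml; apply: eq_bigr => x _.
  by rewrite lazy_avgE; field.
lra.
Qed.

Lemma iter_lazy_avg_sqr k f : \sum_x f x = 0 ->
  \sum_x iter k lazy_avg f x ^+ 2 <= (1 - gamma / 2) ^+ k * \sum_x f x ^+ 2.
Proof.
move=> f0; have s0 j : \sum_x iter j lazy_avg f x = 0.
  by elim: j => //= j IH; rewrite sum_lazy_avg.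
elim: k => [|k IH]; first by rewrite mul1r.
rewrite iterS exprS -mulrA; apply: le_trans (lazy_avg_sqr (s0 k)) _.
by apply: ler_wpM2l; [have := gamma_gt0; have := gamma_le1; lra|exact: IH].
Qed.

(** The indicator of y minus its mean has sum 0 and squared norm at most 1. One value of its iterate
    is bounded by the norm, hence the square root in [rate]. *)
Lemma kern_decay k x y : `|kern k x y - #|V|%:R^-1| <= rate ^+ k.
Proof.
set a : R := #|V|%:R^-1.
have V0 : #|V|%:R != 0 :> R.
  by rewrite pnatr_eq0 -lt0n; apply/card_gt0P; exists x.
have sa : \sum_(z : V) a = 1 by rewrite sumr_const -mulr_natl divff.
pose f z : R := (z == y)%:R - a.
have sd (g : V -> R) : \sum_z (z == y)%:R * g z = g y.
  rewrite (bigD1 y) //= eqxx mul1r big1 ?addr0 // => z /negPf->; exact: mul0r.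
have f0 : \sum_z f z = 0.
  rewrite sumrB sa; have := sd (fun=> 1); under eq_bigr => z _ do rewrite mulr1.
  by move=> ->; rewrite subrr.
have ff : \sum_z f z ^+ 2 <= 1.
  have -> : \sum_z f z ^+ 2 = \sum_z ((z == y)%:R * (1 - 2 * a) + a * a).
    by apply: eq_bigr => z _; rewrite /f; case: eqP => _ /=; ring.
  rewrite big_split /= sd -mulr_sumr sa mulr1.
  have : 0 <= a by rewrite invr_ge0.
  lra.
have it j z : iter j lazy_avg f z = kern j z y - a.
  elim: j z => // j IH z; rewrite kernS -lazy_avgB iterS.
  by apply: eq_bigr => w _; rewrite IH.
have q0 : 0 <= 1 - gamma / 2 by move: gamma_gt0 gamma_le1; lra.
rewrite -(@ler_pXn2r _ 2) ?nnegrE ?exprn_ge0 ?sqrtr_ge0 //.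
rewrite -exprM mulnC exprM sqr_sqrtr // real_normK ?num_real // -it.
apply: (@le_trans _ _ (\sum_z iter k lazy_avg f z ^+ 2)).
  by rewrite (bigD1 x) //= lerDl sumr_ge0 // => z _; apply: sqr_ge0.
apply: le_trans (iter_lazy_avg_sqr k f0) _.
by rewrite ler_piMr ?exprn_ge0.
Qed.

End Decay.

Section Trajectories.

(** Expectation of F over the first n steps. F takes plain sequences, so that a first step can be
    put in front of a shorter trajectory. *)
Definition traj_sum n x (F : seq V -> R) : R :=
  \sum_(w : n.-tuple V) traj_weight R E x w * F w.

Lemma traj_sum0 x F : traj_sum 0 x F = F [::].
Proof.
rewrite /traj_sum (big_pred1 [tuple]) /= ?mul1r // => t.
by rewrite (tuple0 t); apply/esym/eqP.
Qed.

(** Markov property at time 1. *)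
Lemma traj_sumS n x F :
  traj_sum n.+1 x F = lazy_avg (fun z => traj_sum n z (fun w => F (z :: w))) x.
Proof.
rewrite /traj_sum /lazy_avg.
under [RHS]eq_bigr => z _ do rewrite mulr_sumr.
rewrite (pair_big xpredT xpredT (fun z (w : n.-tuple V) =>
  lazy_step R E x z * (traj_weight R E z w * F (z :: w)))) /=.
rewrite (reindex (fun p : V * n.-tuple V => [tuple of p.1 :: p.2])) /=.
  by apply: eq_bigr => -[z w] _ /=; rewrite mulrA.
exists (fun t => (thead t, [tuple of behead t])) => [[z w] _ | t _] /=.
  by rewrite theadE; congr pair; apply: val_inj.
by apply: val_inj; rewrite /= [in RHS](tuple_eta t).
Qed.

Lemma walk_probE x n (A : pred (seq V)) :
  walk_prob R E x [pred w : n.-tuple V | A w] = traj_sum n x (fun w => (A w)%:R).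
Proof.
rewrite /walk_prob /traj_sum big_mkcond; apply: eq_bigr => w _ /=.
by case: (A w); rewrite ?mulr1 ?mulr0.
Qed.

Lemma traj_sum_le n x F F' : (forall w, F w <= F' w) -> traj_sum n x F <= traj_sum n x F'.
Proof.
elim: n x F F' => [|n IH] x F F' FF'; first by rewrite !traj_sum0.
by rewrite !traj_sumS; apply: lazy_avg_le => z; apply: IH.
Qed.

Lemma traj_sum1 n x : traj_sum n x (fun=> 1) = 1.
Proof.
elim: n x => [|n IH] x; first by rewrite traj_sum0.
rewrite traj_sumS -[RHS](lazy_avg_cst 1 x).
by apply: eq_bigr => z _; rewrite IH.
Qed.

Lemma walk_law_kern x t y : walk_law R E x t y = kern t x y.
Proof.
rewrite /walk_law (walk_probE x t (fun w => last x w == y)).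
elim: t x => [|t IH] x; first by rewrite traj_sum0.
by rewrite traj_sumS kernS; apply: eq_bigr => z _; rewrite -IH.
Qed.

(* A union bound over the times at which the walk is at x. *)
Lemma hit_prob_le_kern y x s :
  hit_prob E y x s <= \sum_(k < (Num.truncn s).+1) kern k y x.
Proof.
rewrite /hit_prob; set n := Num.truncn s.
(* With its start, the trajectory has n + 1 entries, so the index is at most n exactly when x
   occurs. *)
have -> : walk_prob R E y [pred w : n.-tuple V | (index x (y :: w) <= n)%N] =
    traj_sum n y (fun w => (x \in y :: w)%:R).
  rewrite /walk_prob /traj_sum big_mkcond; apply: eq_bigr => w _ /=.
  have -> : (x \in y :: w) = (index x (y :: w) <= n)%N.
    by rewrite -[LHS]index_mem -[size (y :: w)]/((size w).+1) size_tuple ltnS.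
  by case: (_ <= n)%N; rewrite ?mulr1 ?mulr0.
elim: n y => [|n IH] y.
  by rewrite traj_sum0 big_ord1 /kern /= inE eq_sym.
rewrite big_ord_recl [kern _ _ _ in leRHS](_ : _ = (y == x)%:R) //.
have [<-|xy] := eqVneq x y.
  apply: (@le_trans _ _ 1).
    rewrite -[leRHS](traj_sum1 n.+1 x); apply: traj_sum_le => w.
    by rewrite mem_head.
  by rewrite lerDl sumr_ge0 // => k _; apply: kern_ge0.
rewrite add0r traj_sumS.
have -> : \sum_(i < n.+1) kern (lift ord0 i) y x =
    lazy_avg (fun z => \sum_(i < n.+1) kern i z x) y.
  rewrite /lazy_avg; under [RHS]eq_bigr => z _ do rewrite mulr_sumr.
  by rewrite exchange_big.
apply: lazy_avg_le => z; apply: le_trans (IH z).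
apply: traj_sum_le => w.
by rewrite (in_cons y) (negPf xy).
Qed.

(** This bound also serves off the good event, where degrees are arbitrary: the step probabilities
    sum to 1/2 at an isolated vertex and to 1 elsewhere. *)
Lemma hit_prob_le1 y x (s : R) : hit_prob E y x s <= 1.
Proof.
have sum_step z : lazy_avg (fun=> 1) z <= 1.
  rewrite /lazy_avg; under eq_bigr => u _ do rewrite mulr1.
  rewrite big_split /= (bigD1 z) //= eqxx big1 ?addr0 => [|u]; last first.
    by rewrite eq_sym => /negPf->; rewrite mul0r.
  rewrite -mulr_suml.
  have -> : \sum_u (adj E z u)%:R = (deg E z)%:R :> R.
    rewrite /deg -sum1_card natr_sum big_mkcond [RHS]big_mkcond /=.
    by apply: eq_bigr => u _; rewrite !inE; case: adj.
  have [->|dz] := eqVneq (deg E z) 0%N; first by rewrite mulr0n mul0r /= mulr1n; lra.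
  have -> : (deg E z)%:R / (2 * (deg E z)%:R) = 2^-1 :> R.
    by field; rewrite pnatr_eq0.
  rewrite /= mulr1n; lra.
rewrite /hit_prob /walk_prob; set n := Num.truncn s.
apply: (@le_trans _ _ (traj_sum n y (fun=> 1))).
  rewrite big_mkcond; apply: ler_sum => w _; case: ifP; rewrite mulr1 // => _.
  by elim: (w : seq V) y => //= z w' IH u; rewrite mulr_ge0 ?lazy_step_ge0.
elim: n y => [|n IH] y; first by rewrite traj_sum0.
by rewrite traj_sumS; apply: le_trans (lazy_avg_le y IH) (sum_step y).
Qed.

End Trajectories.

Lemma geometric_tail (s : R) m n : 0 <= s -> s < 1 ->
  \sum_(k < n) (if (m < k)%N then s ^+ k else 0) <= s ^+ m / (1 - s).
Proof.
move=> s0 s1; have s1' : 0 < 1 - s by rewrite subr_gt0.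
rewrite ler_pdivlMr //.
(* Adding the telescoping remainder s^n makes the bound inductive. *)
suff : (\sum_(k < n) (if (m < k)%N then s ^+ k else 0)) * (1 - s) +
    (if (m < n)%N then s ^+ n else s ^+ m) <= s ^+ m.
  by apply: le_trans; rewrite lerDl; case: ifP => _; apply: exprn_ge0.
elim: n => [|n IH]; first by rewrite big_ord0 mul0r add0r.
rewrite big_ord_recr /= mulrDl; case: (ltnP m n) IH => [mn|nm] IH.
  by rewrite (leqW mn) exprS; lra.
rewrite mul0r addr0; case: ltnP => // mn.
have -> : n = m by apply/eqP; rewrite eqn_leq nm -ltnS mn.
move: IH; have : s ^+ m.+1 <= s ^+ m by rewrite exprS ler_piMl ?exprn_ge0 // ltW.
have -> : n = m by apply/eqP; rewrite eqn_leq nm -ltnS mn.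
lra.
Qed.

(** The total variation distance is at most the sum over all vertices of the deviations from 1/|V|,
    each controlled by [kern_decay]. *)
Lemma mixing_time_le (gamma : R) t : 0 < gamma <= 1 -> gamma <= spectral_gap R E ->
  #|V|%:R * Num.sqrt (1 - gamma / 2) ^+ t <= 4^-1 -> (mixing_time R E <= t)%N.
Proof.
move=> /andP[g0 g1] gap small.
have mt : mixed R E t.
  rewrite /mixed; apply: bigmax_le; first by rewrite invr_ge0.
  move=> x _; rewrite /tv_dist; apply: bigmax_le; first by rewrite invr_ge0.
  move=> A _; rewrite -sumrB; apply: le_trans (ler_norm_sum _ _ _) _.
  apply: le_trans small.
  apply: (@le_trans _ _ (\sum_(y : V) Num.sqrt (1 - gamma / 2) ^+ t)); last first.
    by rewrite sumr_const mulr_natl.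
  rewrite big_mkcond; apply: ler_sum => y _; case: ifP => _; last first.
    by rewrite exprn_ge0 ?sqrtr_ge0.
  have -> : stationary R E y = #|V|%:R^-1.
    rewrite /stationary (degE rE) (eq_bigr (fun=> d)) => [|z _]; last exact: degE.
    by rewrite sum_nat_const natrM invfM mulrCA divff ?mulr1.
  rewrite walk_law_kern; exact: kern_decay.
rewrite /mixing_time; case: pselect => // h.
by case: ex_minnP => m _; apply.
Qed.

(** In the union bound, times up to m contribute nothing, as y is further than m from x. A later
    time k costs at most 1/|V| + s^k, where s is the square root; at most a t + 1 times occur, and
    the powers form a geometric tail. *)
Lemma hit_prob_bound (gamma a : R) t m x y :
  0 < gamma <= 1 -> gamma <= spectral_gap R E -> 0 <= a ->
  #|V|%:R * Num.sqrt (1 - gamma / 2) ^+ t <= 4^-1 -> y \notin ball E x m ->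
  hit_prob E y x (a * (mixing_time R E)%:R) <=
    (a * t%:R + 1) / #|V|%:R +
    Num.sqrt (1 - gamma / 2) ^+ m / (1 - Num.sqrt (1 - gamma / 2)).
Proof.
move=> g01 gap a0 small yx; have tm := mixing_time_le g01 gap small.
move: g01 => /andP[g0 g1].
set s := Num.sqrt _ in small *.
have s1 : s < 1 by rewrite /s -[ltRHS]sqrtr1 ltr_sqrt //; lra.
apply: le_trans (hit_prob_le_kern _ _ _) _.
set n := Num.truncn _.
have kb (k : 'I_n.+1) : kern k y x <= #|V|%:R^-1 + (if (m < k)%N then s ^+ k else 0).
  case: ltnP => [_|km].
    rewrite -lerBlDl; apply: le_trans (ler_norm _) _; exact: kern_decay.
  rewrite kern_far ?addr_ge0 ?invr_ge0 //.
  by apply: contra yx; apply/fintype.subsetP/ballS.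
apply: le_trans (ler_sum _ (fun k _ => kb k)) _.
rewrite big_split /= lerD ?geometric_tail ?sqrtr_ge0 //.
rewrite sumr_const card_ord -[leLHS]mulr_natl ler_wpM2r ?invr_ge0 //.
rewrite -addn1 natrD lerD2r; apply: (@le_trans _ _ (a * (mixing_time R E)%:R)).
  by rewrite truncn_le mulr_ge0.
by rewrite ler_wpM2l // ler_nat.
Qed.

End LazyWalk.

(** * Expectations and finite random variables *)

Section FiniteRandomVariables.
Local Open Scope classical_set_scope.
Context (disp : measure_display) (Omega : measurableType disp) (R : realType).
Variable P : probability Omega R.

(* The integral of a nonnegative function is the supremum of the integrals of the
   simple functions below it. *)
Lemma le_expectation (f g : Omega -> R) :
  (forall w, 0 <= f w) -> (forall w, f w <= g w) -> ('E_P[f] <= 'E_P[g])%E.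
Proof.
move=> f0 fg; have g0 w : 0 <= g w by apply: le_trans (fg w).
rewrite unlock !ge0_integralTE => [|w|w]; rewrite ?lee_fin //.
apply: ereal_sup_le => _ [h hf <-]; exists h => // w /=.
by apply: le_trans (hf w) _; rewrite lee_fin.
Qed.

Lemma finite_rv_measurable (T : finType) (X : Omega -> T) (A : set T) :
  finite_rv X -> measurable (X @^-1` A).
Proof.
move=> mX; rewrite (_ : X @^-1` A = \bigcup_(t in A) X @^-1` [set t]).
  by apply: fin_bigcup_measurable.
by apply/seteqP; split=> w /= => [At|[t At ->]] //; exists (X w).
Qed.

Lemma finite_rv_pair (T U : finType) (X : Omega -> T) (Y : Omega -> U) :
  finite_rv X -> finite_rv Y -> finite_rv (fun w => (X w, Y w)).
Proof.
move=> mX mY [t u]; rewrite (_ : _ @^-1` _ = X @^-1` [set t] `&` Y @^-1` [set u]).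
  exact: measurableI.
by apply/seteqP; split=> w /= [-> ->].
Qed.

Lemma prob_finite_rv (T : finType) (X : Omega -> T) (A : pred T) :
  finite_rv X -> (P (X @^-1` [set t | A t]) = \sum_(t | A t) P (X @^-1` [set t]))%E.
Proof.
move=> mX; rewrite -big_filter.
have -> : [set t | A t] = [set` [seq t <- index_enum T | A t]].
  by apply/seteqP; split=> t; rewrite /= mem_filter mem_index_enum andbT.
elim: [seq _ <- _ | _] (filter_uniq A (index_enum_uniq T)) => [_|t s IH /= /andP[ts us]].
  rewrite big_nil (_ : _ @^-1` _ = set0) ?measure0 //.
  by apply/seteqP; split=> w.
rewrite big_cons -(IH us).
have -> : X @^-1` [set` t :: s] = X @^-1` [set t] `|` X @^-1` [set` s].
  apply/seteqP; split=> w /=; rewrite inE.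
    by case/orP => [/eqP->|]; [left|right].
  by case=> [->|->]; rewrite ?eqxx ?orbT.
apply: measureU; [exact: mX|exact: finite_rv_measurable|].
by apply/seteqP; split=> w //= [-> ]; apply/negP.
Qed.

(** Conditioning on G: given G = t, the vertex falls in C t with probability |C t| / |V|. *)
Lemma prob_uniform_indep (T V : finType) (G : Omega -> T) (X : Omega -> V)
    (A : pred T) (C : T -> {set V}) (b : R) :
  finite_rv G -> finite_rv X ->
  (forall t x, P (G @^-1` [set t] `&` X @^-1` [set x]) =
     (P (G @^-1` [set t]) * (#|V|%:R^-1)%:E)%E) ->
  0 <= b -> (forall t, A t -> #|C t|%:R / #|V|%:R <= b) ->
  (P [set w | A (G w) && (X w \in C (G w))] <= b%:E)%E.
Proof.
move=> mG mX ind b0 Cb.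
have mGX := finite_rv_pair mG mX.
rewrite (prob_finite_rv (fun p => A p.1 && (p.2 \in C p.1)) mGX) /=.
have -> : (\sum_(p | A p.1 && (p.2 \in C p.1)) P ((fun w => (G w, X w)) @^-1` [set p]) =
    \sum_(t | A t) \sum_(x | x \in C t) P (G @^-1` [set t]) * (#|V|%:R^-1)%:E)%E.
  rewrite pair_big_dep /=; apply: eq_bigr => -[t x] _ /=; rewrite -(ind t x); congr (P _).
  by apply/seteqP; split=> w /= [-> ->].
have finP t : P (G @^-1` [set t]) = (fine (P (G @^-1` [set t])))%:E.
  by rewrite fineK // fin_num_measure.
pose p t := fine (P (G @^-1` [set t])).
have p0 t : 0 <= p t by rewrite fine_ge0.
have p1 : \sum_t p t = 1.
  apply: EFin_inj; rewrite -sumEFin.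
  have := prob_finite_rv xpredT mG; rewrite (_ : _ @^-1` _ = setT); last first.
    by apply/seteqP; split.
  by rewrite probability_setT => ->; apply: eq_bigr => t _; rewrite -finP.
under eq_bigr => t _ do under eq_bigr => x _ do rewrite finP -EFinM.
under eq_bigr => t _ do rewrite sumEFin.
rewrite sumEFin lee_fin.
apply: (@le_trans _ _ (\sum_t p t * b)); last by rewrite -mulr_suml p1 mul1r.
rewrite big_mkcond; apply: ler_sum => t _; case: ifP => At; last by rewrite mulr_ge0.
rewrite sumr_const -[leLHS]mulr_natr -mulrA [_^-1 * _]mulrC.
by apply: ler_wpM2l; [exact: p0|exact: Cb].
Qed.

Lemma cvg_prob_setC (A : nat -> set Omega) :
  (\forall N \near \oo, measurable (A N)) ->
  P (A N) @[N --> \oo] --> 1%E -> P (~` A N) @[N --> \oo] --> 0%E.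
Proof.
move=> mA A1.
have : (1 - P (A N))%E @[N --> \oo] --> (1 - 1)%E.
  by apply: cvgeB => //; apply: cvg_cst.
rewrite subee //; apply: cvg_trans; apply: near_eq_cvg.
by near do rewrite probability_setC //.
Unshelve. all: by end_near. Qed.

(** The indicator of the complement of A N plus |e N| dominates f N, and its mean tends to 0. The
    absolute value keeps this majorant nonnegative. *)
Lemma expectation_cvg0 (f : nat -> Omega -> R) (A : nat -> set Omega) (e : nat -> R) :
  (\forall N \near \oo, measurable (A N)) ->
  P (A N) @[N --> \oo] --> 1%E ->
  (forall N w, 0 <= f N w) ->
  (\forall N \near \oo, forall w, f N w <= 1) ->
  (\forall N \near \oo, forall w, A N w -> f N w <= e N) ->
  e N @[N --> \oo] --> 0 ->
  ('E_P[f N] @[N --> \oo] --> 0)%E.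
Proof.
move=> mA A1 f0 f1 fe e0.
have lim0 : (P (~` A N) + `|e N|%:E)%E @[N --> \oo] --> 0%E.
  rewrite -[X in _ --> X]adde0; apply: cvgeD => //; first exact: cvg_prob_setC.
  by apply: cvg_EFin; [exact: nearW|rewrite -[X in _ --> X](normr0 R); exact: cvg_norm].
apply: squeeze_cvge lim0; last by apply: cvg_cst.
near=> N; have mAN : measurable (A N) by near: N.
have f1N : forall w, f N w <= 1 by near: N.
have feN : forall w, A N w -> f N w <= e N by near: N.
have mAC : measurable (~` A N) by exact: measurableC.
rewrite expectation_ge0 //=.
apply: (@le_trans _ _ 'E_P[(fun w => \1_(~` A N) w + `|e N|)%R]%E).
  apply: le_expectation => // w; rewrite indicE in_setC.
  have [wA|wA] := boolP (w \in A N); rewrite /= ?add0r.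
    apply: le_trans (ler_norm _); exact/feN/set_mem.
  by rewrite -[leLHS]addr0 lerD.
rewrite unlock; under eq_integral do rewrite EFinD.
rewrite ge0_integralD //=.
- by rewrite integral_indic // setIT integral_cst //= probability_setT mule1.
- by apply/measurable_realfun.measurable_EFinP; exact: measurable_realfun.measurable_indic.
Unshelve. all: by end_near. Qed.

End FiniteRandomVariables.

(** * Limits on the logarithmic scale *)

Section Asymptotics.
Local Open Scope classical_set_scope.
Variable R : realType.
Implicit Types (c s q : R).

Lemma near_ln_gt (b c : R) : 0 < c -> \forall N \near \oo, b < c * ln (N%:R : R).
Proof.
move=> c0; near=> N.
have N1 : expR (b / c) < N%:R by near: N; exact: nbhs_infty_gtr.
have N0 : 0 < N%:R :> R by apply: lt_trans N1; exact: expR_gt0.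
by rewrite mulrC -ltr_pdivrMr // -[ltLHS]expRK ltr_ln ?posrE ?expR_gt0.
Unshelve. all: by end_near. Qed.

Lemma cvg_expR_ln c : 0 < c -> expR (- (c * ln (N%:R : R))) @[N --> \oo] --> (0 : R).
Proof.
move=> c0; apply/cvgrPdist_lt => e e0; near=> N.
rewrite sub0r normrN gtr0_norm ?expR_gt0 // -[ltRHS]lnK ?posrE // ltr_expR ltrNl.
by near: N; exact: near_ln_gt.
Unshelve. all: by end_near. Qed.

Lemma cvg_truncn_ln c : 0 < c -> Num.truncn (c * ln (N%:R : R)) @[N --> \oo] --> \oo.
Proof.
move=> c0; apply/cvgnyPge => A; near=> N.
have h : A%:R < c * ln (N%:R : R) by near: N; exact: near_ln_gt.
rewrite truncn_ge_nat; first exact: ltW.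
by apply: le_trans (ltW h).
Unshelve. all: by end_near. Qed.

Lemma cvg_expr_truncn_ln s c : 0 <= s < 1 -> 0 < c ->
  s ^+ Num.truncn (c * ln (N%:R : R)) @[N --> \oo] --> (0 : R).
Proof.
move=> /andP[s0 s1] c0.
apply: (cvg_comp (fun N => Num.truncn (c * ln (N%:R : R))) (GRing.exp s)).
  exact: cvg_truncn_ln.
by apply: cvg_expr; rewrite ger0_norm.
Qed.

Lemma ln_ge0_nat (N : nat) : 0 <= ln (N%:R : R).
Proof. by case: N => [|N]; [rewrite ln0 | rewrite ln_ge0 // ler1n]. Qed.

(** With k = c ln(d - 1), the power (d - 1)^(c ln N) equals N^k, and dividing by N leaves N^(k - 1)
    with k < 1. *)
Lemma cvg_ball_ratio (d : nat) c : (3 <= d)%N -> 0 < c -> c * ln (d%:R - 1) < 1 ->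
  (1 + d * d.-1 ^ Num.truncn (c * ln (N%:R : R)))%N%:R / N%:R @[N --> \oo] --> (0 : R).
Proof.
move=> d3 c0 cd; set q : R := d%:R - 1 in cd.
have q2 : 2 <= q.
  have : 3%:R <= d%:R :> R by rewrite ler_nat.
  by rewrite /q; lra.
have qE : d.-1%:R = q by rewrite /q -subn1 natrB //; apply: leq_trans d3.
have q0 : 0 < q by apply: lt_le_trans q2.
have lq : 0 <= ln q by rewrite ln_ge0 //; lra.
pose k := c * ln q.
have lim : (1 + d%:R) * expR (- ((1 - k) * ln (N%:R : R))) @[N --> \oo] --> (0 : R).
  rewrite -[X in _ --> X](mulr0 (1 + d%:R)); apply: cvgMr.
  by apply: cvg_expR_ln; rewrite subr_gt0.
apply: squeeze_cvgr lim; last exact: cvg_cst.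
near=> N; rewrite divr_ge0 //=.
have N0 : 0 < N%:R :> R by near: N; exact: nbhs_infty_gtr.
have lN := ln_ge0_nat N.
rewrite ler_pdivrMr // -{3}(lnK N0) -mulrA -expRD.
have -> : - ((1 - k) * ln N%:R) + ln N%:R = k * ln (N%:R : R) by ring.
have k0 : 0 <= k * ln (N%:R : R) by rewrite !mulr_ge0 // ltW.
have e1 : 1 <= expR (k * ln (N%:R : R)) by rewrite -[leLHS]expR0 ler_expR.
rewrite natrD natrM natrX qE mulrDl mul1r lerD // ler_wpM2l //.
rewrite -{1}(lnK (_ : q \in Num.pos)) ?posrE // -expRM_natl ler_expR.
rewrite /k [leRHS]mulrAC; apply: ler_wpM2r => //.
by rewrite truncn_le mulr_ge0 // ltW.
Unshelve. all: by end_near. Qed.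

(** An integer just above the solution t of N s^t = 1/4; for s the decay rate of the kernel it
    bounds the mixing time. *)
Definition mixing_scale s (N : nat) : nat := (Num.truncn (ln (4 * N%:R) / - ln s)).+1.

Lemma mixing_scaleP s N : 0 < s -> s < 1 -> (0 < N)%N ->
  N%:R * s ^+ mixing_scale s N <= 4^-1.
Proof.
move=> s0 s1 N0; have NR : 0 < N%:R :> R by rewrite ltr0n.
have ls : 0 < - ln s by rewrite oppr_gt0 ln_lt0 // s0.
suff h : s ^+ mixing_scale s N <= (4 * N%:R)^-1.
  apply: le_trans (ler_wpM2l (ltW NR) h) _.
  by rewrite invfM mulrCA divff ?mulr1 // gt_eqF.
have N4 : 0 < 4 * N%:R :> R by rewrite mulr_gt0.
rewrite -{1}(lnK (_ : s \in Num.pos)) ?posrE // -expRM_natl.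
rewrite -[leRHS](lnK (_ : _ \in Num.pos)) ?posrE ?invr_gt0 // ler_expR lnV ?posrE //.
rewrite lerNr -mulrN -ler_pdivrMr //; apply/ltW.
exact: truncnS_gt.
Qed.

(* ln N is bounded by 4 N^(1/4), hence the numerator is of order N^(1/2). *)
Lemma cvg_mixing_scale s : 0 < s -> s < 1 ->
  (ln N%:R * (mixing_scale s N)%:R + 1) / N%:R @[N --> \oo] --> (0 : R).
Proof.
move=> s0 s1; have ls : 0 < - ln s by rewrite oppr_gt0 ln_lt0 // s0.
pose C := (- ln s)^-1; have C0 : 0 < C by rewrite invr_gt0.
have lim : (64 * C + 5) * expR (- (2^-1 * ln (N%:R : R))) @[N --> \oo] --> (0 : R).
  rewrite -[X in _ --> X](mulr0 (64 * C + 5)); apply: cvgMr.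
  by apply: cvg_expR_ln; rewrite invr_gt0.
apply: squeeze_cvgr lim; last exact: cvg_cst.
near=> N.
have N1 : 1 <= N%:R :> R by near: N; exact: nbhs_infty_ger.
have N0 : 0 < N%:R :> R by apply: lt_le_trans N1.
have lN := ln_ge0_nat N.
have l4 : ln (4 : R) <= 4.
  have -> : (4 : R) = 1 + 3 by ring.
  by apply: (@le_trans _ _ 3); [apply: le_ln1Dx; lra|lra].
rewrite divr_ge0 ?addr_ge0 ?mulr_ge0 //=.
pose u := expR (4^-1 * ln (N%:R : R)).
have u1 : 1 <= u by rewrite -[leLHS]expR0 ler_expR mulr_ge0.
have lu : ln N%:R <= 4 * u.
  by have := expR_ge1Dx (4^-1 * ln (N%:R : R)); rewrite -/u; lra.
have u2 : expR (2^-1 * ln (N%:R : R)) = u * u.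
  by rewrite -expRD; congr expR; field.
have NE : N%:R = (u * u) * (u * u).
  by rewrite -u2 -expRD -[LHS](lnK N0); congr expR; field.
have tb : (mixing_scale s N)%:R <= 8 * u * C + 1.
  rewrite /mixing_scale -addn1 natrD lerD2r.
  apply: (@le_trans _ _ (ln (4 * N%:R) / - ln s)).
    rewrite truncn_le mulr_ge0 ?invr_ge0 ?(ltW ls) // ln_ge0 //.
    by apply: le_trans N1 _; rewrite ler_peMl //; lra.
  rewrite ler_wpM2r ?invr_ge0 ?(ltW ls) // lnM ?posrE //; lra.
rewrite expRN u2 ler_pdivrMr //.
have -> : (64 * C + 5) / (u * u) * N%:R = (64 * C + 5) * (u * u).
  by rewrite NE; field; rewrite gt_eqF ?expR_gt0.
apply: (@le_trans _ _ (4 * u * (8 * u * C + 1) + 1)).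
  rewrite lerD2r ler_pM //.
have uu : u <= u * u by rewrite ler_peMl //; lra.
have Cu : 0 <= C * (u * u) by rewrite !mulr_ge0 //; lra.
nra.
Unshelve. all: by end_near. Qed.

End Asymptotics.

(** * Random regular graphs *)

Section ExpanderGraphs.
Local Open Scope classical_set_scope.
Variables (R : realType) (disp : measure_display) (Omega : measurableType disp).
Variables (P : probability Omega R) (V : nat -> finType).
Hypothesis cardV : forall N, (0 < N)%N -> #|V N| = N.
Variable G : forall N, Omega -> {set {set V N}}.
Hypothesis G_rv : forall N, (0 < N)%N -> finite_rv (G N).
Hypothesis G_simple : forall N w, (0 < N)%N -> simple_graph (G N w).
Hypothesis G_connected : forall N w, (0 < N)%N -> connected_graph (G N w).
Variables (d : nat) (alpha0 gamma : R).
Hypotheses (d_ge3 : (3 <= d)%N) (alpha0_gt0 : 0 < alpha0) (gamma_gt0 : 0 < gamma).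

Definition good_graph N (g : {set {set V N}}) : Prop :=
  [/\ regular_graph g d,
      forall x : V N, at_most_one_cycle g (gball g x (alpha0 * ln N%:R)) &
      gamma <= spectral_gap R g].

Hypothesis G_prop : P [set w | good_graph (G N w)] @[N --> \oo] --> 1%E.

Lemma near_pos : \forall N \near \oo, (0 < N)%N.
Proof. exact: nbhs_infty_gt. Qed.

Lemma good_measurable : \forall N \near \oo, measurable [set w | good_graph (G N w)].
Proof.
near=> N; have N0 : (0 < N)%N by near: N; exact: near_pos.
exact: (finite_rv_measurable (@good_graph N) (G_rv N0)).
Unshelve. all: by end_near. Qed.

Section Walk.
Variables (alpha' : R) (X : forall N, Omega -> V N).
Hypotheses (alpha'_gt0 : 0 < alpha') (alpha'_lt : alpha' < (2 * ln (d%:R - 1))^-1).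

(** The bound on alpha' says that 2 alpha' ln(d - 1) < 1, so balls of the doubled radius have size
    of order a power of N less than 1. *)
Lemma ball_fraction_cvg0 :
  'E_P[(fun w => #|gball (G N w) (X N w) (2 * (alpha' * ln N%:R))|%:R / #|V N|%:R)%R]%E
    @[N --> \oo] --> 0%E.
Proof.
have q2 : 2 <= d%:R - 1 :> R.
  have : 3%:R <= d%:R :> R by rewrite ler_nat.
  lra.
have lq : 0 < ln (d%:R - 1) :> R by rewrite ln_gt0 //; lra.
apply: expectation_cvg0 good_measurable G_prop _ _ _ (@cvg_ball_ratio R d (2 * alpha') d_ge3 _ _).
- by move=> N w; rewrite divr_ge0.
- near=> N => w; have N0 : (0 < N)%N by near: N; exact: near_pos.
  by rewrite ler_pdivrMr ?mul1r ?ler_nat ?max_card // ltr0n cardV.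
- near=> N => w [reg _ _]; have N0 : (0 < N)%N by near: N; exact: near_pos.
  have l0 := ln_ge0_nat R N.
  rewrite gball_ball ?mulr_ge0 ?(ltW alpha'_gt0) // cardV // ler_wpM2r ?invr_ge0 //.
  by rewrite ler_nat mulrA (card_ball (G_connected w N0)).
- by rewrite mulr_gt0.
- rewrite -mulrA mulrCA -ltr_pdivlMr ?mul1r //.
  by rewrite mulr_gt0.
Unshelve. all: by end_near. Qed.

Lemma hitting_cvg0 :
  'E_P[(fun w => \big[Num.max/0]_(y | y \notin gball (G N w) (X N w) (alpha' * ln N%:R))
           hit_prob (G N w) y (X N w) (ln N%:R * (mixing_time R (G N w))%:R))%R]%E
    @[N --> \oo] --> 0%E.
Proof.
(* The decay estimates ask for a constant at most 1; the minimum is still a lower bound of the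
   gap. *)
pose g1 := Num.min gamma 1.
have g01 : 0 < g1 <= 1 by rewrite lt_min gamma_gt0 ltr01 /= ge_min lexx orbT.
pose s := Num.sqrt (1 - g1 / 2).
have [g0 g1'] := andP g01.
have s0 : 0 < s by rewrite sqrtr_gt0; lra.
have s1 : s < 1 by rewrite /s -[ltRHS]sqrtr1 ltr_sqrt //; lra.
pose e N := (ln N%:R * (mixing_scale s N)%:R + 1) / N%:R +
  s ^+ Num.truncn (alpha' * ln (N%:R : R)) / (1 - s).
have e0 : e N @[N --> \oo] --> 0.
  rewrite -[X in _ --> X]addr0; apply: cvgD; first exact: cvg_mixing_scale.
  rewrite -[X in _ --> X](mul0r (1 - s)^-1); apply: cvgMl.
  by apply: cvg_expr_truncn_ln => //; rewrite ltW.
apply: expectation_cvg0 good_measurable G_prop _ _ _ e0.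
- by move=> N w; apply: bigmax_ge_id.
- near=> N => w; have N0 : (0 < N)%N by near: N; exact: near_pos.
  by apply: bigmax_le => // y _; apply: hit_prob_le1.
- near=> N => w [reg _ gap]; have N0 : (0 < N)%N by near: N; exact: near_pos.
  have l0 := ln_ge0_nat R N.
  have gap1 : g1 <= spectral_gap R (G N w) by apply: le_trans gap; rewrite ge_min lexx.
  have d0 : (0 < d)%N by apply: leq_trans d_ge3.
  have eN : 0 <= e N.
    apply: addr_ge0; first by rewrite divr_ge0 // addr_ge0 // mulr_ge0.
    by rewrite divr_ge0 ?subr_ge0 ?exprn_ge0 // ltW.
  apply: bigmax_le => // y; rewrite gball_ball ?mulr_ge0 ?(ltW alpha'_gt0) // => yX.
  have := hit_prob_bound (G_connected w N0) reg d0 g01 gap1 l0 _ yX.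
  rewrite cardV // -/s; apply; exact: mixing_scaleP.
Unshelve. all: by end_near. Qed.

End Walk.

Section LocalEquivalence.
Variables (alpha' : R) (X Y : forall N, Omega -> V N).
Hypotheses (alpha'_gt0 : 0 < alpha') (alpha'_lt : alpha' < alpha0).
Hypothesis X_rv : forall N, (0 < N)%N -> finite_rv (X N).
Hypothesis Y_rv : forall N, (0 < N)%N -> finite_rv (Y N).
Hypothesis X_unif : forall N, (0 < N)%N -> uniform_on P (X N) [set: V N]%SET.
Hypothesis Y_unif : forall N, (0 < N)%N -> uniform_on P (Y N) [set: V N]%SET.
Hypothesis XY_indep : forall N, (0 < N)%N ->
  mutually_independent P (fun i : option bool =>
    if i is Some b then finite_events (if b then X N else Y N)
    else finite_events (G N)).

Lemma XY_indep_G N (b : bool) g x : (0 < N)%N ->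
  P (G N @^-1` [set g] `&` (if b then X N else Y N) @^-1` [set x]) =
  (P (G N @^-1` [set g]) * (#|V N|%:R^-1)%:E)%E.
Proof.
move=> N0; pose Z := if b then X N else Y N.
have PZ : P (Z @^-1` [set x]) = (#|V N|%:R^-1)%:E.
  by rewrite /Z; case: b {Z}; [rewrite X_unif|rewrite Y_unif] => //; rewrite finset.in_setT cardsT.
pose A (i : option bool) := if i is Some _ then Z @^-1` [set x] else G N @^-1` [set g].
have AF (i : option bool) : i \in [fset None; Some b]%fset ->
    (if i is Some b' then finite_events (if b' then X N else Y N)
     else finite_events (G N)) (A i).
  rewrite !inE => /orP[] /eqP -> /=.
    by exists [set g] => //; rewrite setTI.
  by exists [set x] => //; rewrite setTI.
have := XY_indep N0 AF.
rewrite big_fsetU1 ?inE //= big_seq_fset1 /= PZ => <-; congr (P _).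
apply/seteqP; split=> w /=.
  by move=> [Gw Zw] i; rewrite /= !inE => /orP[] /eqP ->.
by move=> h; split; [apply: (h None)|apply: (h (Some b))]; rewrite /= !inE eqxx ?orbT.
Qed.

(** Union bound over three events: the graph is not good, the ball about X has a cycle, or the one
    about Y has. Otherwise both balls are trees. *)
Lemma local_equiv_cvg :
  P [set w | ~ pointed_equiv (G N w)
                 (X N w) (gball (G N w) (X N w) (alpha' * ln N%:R))
                 (Y N w) (gball (G N w) (Y N w) (alpha' * ln N%:R))]
    @[N --> \oo] --> 0%E.
Proof.
pose q : R := d.-1%:R.
have q2 : 2 <= q by rewrite ler_nat; case: (d) d_ge3 => [|[|]].
have q0 : 0 < q by apply: lt_le_trans q2.
pose c := alpha0 - alpha'; have c0 : 0 < c by rewrite subr_gt0.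
pose b N := q^-1 ^+ Num.truncn (c * ln (N%:R : R)).
have b0 : b N @[N --> \oo] --> 0.
  apply: cvg_expr_truncn_ln => //; rewrite invr_ge0 ltW //= invf_lt1 //.
  by apply: lt_le_trans q2; rewrite ltr1n.
have lim : (P (~` [set w | good_graph (G N w)]) + (b N + b N)%:E)%E @[N --> \oo] --> 0%E.
  rewrite -[X in _ --> X]adde0; apply: cvgeD => //.
    by apply: cvg_prob_setC => //; exact: good_measurable.
  apply: cvg_EFin; first exact: nearW.
  by rewrite -[X in _ --> X]addr0; exact: cvgD.
apply: squeeze_cvge lim; last exact: cvg_cst.
near=> N; have N0 : (0 < N)%N by near: N; exact: near_pos.
rewrite measure_ge0 /=.
have mgood : measurable [set w | good_graph (G N w)].
  by near: N; exact: good_measurable.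
pose r := Num.truncn (alpha' * ln (N%:R : R)); pose S := Num.truncn (alpha0 * ln (N%:R : R)).
have lN := ln_ge0_nat R N.
(* Rounding down is superadditive, so the integer radii differ by at least the rounded value of c ln
   N. *)
have rS : (Num.truncn (c * ln (N%:R : R)) + r <= S)%N.
  rewrite truncn_ge_nat ?mulr_ge0 ?(ltW alpha0_gt0) // natrD.
  have h1 : (Num.truncn (c * ln (N%:R : R)))%:R <= c * ln (N%:R : R).
    by rewrite truncn_le mulr_ge0 // ltW.
  have h2 : r%:R <= alpha' * ln (N%:R : R) by rewrite truncn_le mulr_ge0 // ltW.
  by apply: le_trans (lerD h1 h2) _; rewrite -mulrDl subrK.
pose C (g : {set {set V N}}) := [set x | `[< ~ acyclic_on g (ball g x r) >]]%SET.
pose A (g : {set {set V N}}) :=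
  `[< [/\ good_graph g, simple_graph g & connected_graph g] >].
have Cb g : A g -> #|C g|%:R / #|V N|%:R <= b N.
  move=> /asboolP[[reg one _] sg cg].
  have one' x : at_most_one_cycle g (ball g x S).
    by rewrite -gball_ball ?mulr_ge0 ?(ltW alpha0_gt0).
  have rS' : (r <= S)%N by apply: leq_trans rS; rewrite leq_addl.
  have := few_cyclic_balls sg cg reg rS' one'; rewrite -/(C g) => h.
  rewrite ler_pdivrMr ?ltr0n ?cardV // /b exprVn mulrC ler_pdivlMr ?exprn_gt0 //.
  rewrite -natrX -natrM ler_nat -[leqRHS](cardV N0); apply: leq_trans h.
  rewrite leq_mul2l leq_pexp2l ?orbT //; last by rewrite leq_subRL // addnC.
  by case: (d) d_ge3 => [|[|]].
have mE (b' : bool) : measurable [set w | A (G N w) && ((if b' then X N else Y N) w \in C (G N w))].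
  have mZ : finite_rv (if b' then X N else Y N) by case: b'; [exact: X_rv|exact: Y_rv].
  exact: (finite_rv_measurable [set p | A p.1 && (p.2 \in C p.1)]
    (finite_rv_pair (G_rv N0) mZ)).
have bE (b' : bool) :
    (P [set w | A (G N w) && ((if b' then X N else Y N) w \in C (G N w))] <= (b N)%:E)%E.
  apply: prob_uniform_indep => //; first exact: G_rv.
  - by case: b'; [exact: X_rv|exact: Y_rv].
  - by move=> g x; apply: XY_indep_G.
  - by rewrite exprn_ge0 // invr_ge0 ltW.
apply: (@le_trans _ _ (P (~` [set w | good_graph (G N w)] `|`
  ([set w | A (G N w) && (X N w \in C (G N w))] `|`
   [set w | A (G N w) && (Y N w \in C (G N w))])))).
  apply: le_measure; rewrite ?inE.
  - exact: (finite_rv_measurable [set p | ~ pointed_equiv p.1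
       p.2.1 (gball p.1 p.2.1 (alpha' * ln N%:R)) p.2.2 (gball p.1 p.2.2 (alpha' * ln N%:R))]
      (finite_rv_pair (G_rv N0) (finite_rv_pair (X_rv N0) (Y_rv N0)))).
  - apply: measurableU; first exact: measurableC.
    by apply: measurableU; [exact: (mE true)|exact: (mE false)].
  move=> w /= neq; have [gw|] := pselect (good_graph (G N w)); last by left.
  right; have sw := G_simple w N0; have cw := G_connected w N0.
  have Aw : A (G N w) by apply/asboolP.
  rewrite Aw /= !inE; have [ax|ax] := pselect (acyclic_on (G N w) (ball (G N w) (X N w) r)); last first.
    by left.
  right => ay; apply: neq.
  have al0 : 0 <= alpha' * ln (N%:R : R) by rewrite mulr_ge0 // ltW.
  rewrite !gball_ball //; have [reg _ _] := gw.
  exact: (tree_balls_equiv sw cw reg).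
apply: le_trans (measureU2 _ _ _) _.
- exact: measurableC.
- by apply: measurableU; [exact: (mE true)|exact: (mE false)].
rewrite leeD2l // EFinD; apply: le_trans (measureU2 _ (mE true) (mE false)) _.
by apply: leeD; [exact: (bE true)|exact: (bE false)].
Unshelve. all: by end_near. Qed.

End LocalEquivalence.
End ExpanderGraphs.

(** * Heavy-tailed weights *)

Section HeavyWeights.
Variables (R : realType) (V : finType).

Lemma mem_enumeration (xs : seq V) x : uniq xs -> size xs = #|V| -> x \in xs.
Proof.
move=> uxs sxs; have sub : {subset xs <= enum V} by move=> y _; rewrite mem_enum.
have le : (size (enum V) <= size xs)%N by rewrite -cardE sxs.
by have [_ ->] := uniq_min_size uxs sub le; rewrite mem_enum.
Qed.

Lemma sum_index (xs : seq V) (F : nat -> R) : uniq xs -> size xs = #|V| ->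
  \sum_x F (index x xs) = \sum_(i < #|V|) F i.
Proof.
move=> uxs sxs.
have xsV : perm_eq (index_enum V) xs.
  apply: uniq_perm => //; first exact: index_enum_uniq.
  by move=> x; rewrite mem_index_enum mem_enumeration.
rewrite (perm_big _ xsV) /=; case: xs uxs sxs {xsV} => [|x0 xs'] uxs sxs.
  by rewrite big_nil; case: (#|V|) sxs => // _; rewrite big_ord0.
rewrite (big_nth x0) big_mkord -sxs; apply: eq_bigr => i _.
by rewrite index_uniq.
Qed.

Let desc (ws : seq R) := sort (fun a b => b <= a) ws.

Lemma sorted_desc (ws : seq R) i j : (i <= j)%N -> (j < size ws)%N ->
  nth 0 (desc ws) j <= nth 0 (desc ws) i.
Proof.
move=> ij js.
apply: (@sorted_leq_nth _ (fun a b : R => b <= a)) => //.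
- by move=> a b c ab ca; apply: le_trans ca ab.
- by apply: sort_sorted => a b; exact: le_total.
- by rewrite inE size_sort; apply: leq_ltn_trans js.
- by rewrite inE size_sort.
Qed.

(** As at most J entries exceed t, those of rank J or more, counted from 0, are at most t. *)
Lemma sum_desc_tail (ws : seq R) (J : nat) (t : R) :
  (count (fun a => (t < a)%R) ws <= J)%N -> (forall a, a \in ws -> 0 <= a) ->
  \sum_(i < size ws | (J <= i)%N) nth 0 (desc ws) i <=
  \sum_(a <- ws) (if a <= t then a else 0).
Proof.
move=> cJ ws0.
have -> : \sum_(a <- ws) (if a <= t then a else 0) =
    \sum_(i < size ws) (if nth 0 (desc ws) i <= t then nth 0 (desc ws) i else 0).
  have /permPl/(perm_big _) <- := perm_sort (fun a b : R => b <= a) ws.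
  by rewrite (big_nth 0) size_sort big_mkord.
rewrite big_mkcond; apply: ler_sum => i _.
have n0 : 0 <= nth 0 (desc ws) i.
  by apply: ws0; rewrite -(mem_sort (fun a b : R => b <= a)) mem_nth // size_sort.
case: ifP => [Ji|_]; last by case: ifP.
case: (leP (nth 0 (desc ws) i) t) => // ti; exfalso.
(* Otherwise the entries of ranks 0 to i all exceed t, which makes more than J of them. *)
have : (i.+1 <= count (fun a => (t < a)%R) (desc ws))%N.
  rewrite -[desc ws](cat_take_drop i.+1) count_cat.
  apply: leq_trans (leq_addr _ _).
  have sz : size (take i.+1 (desc ws)) = i.+1 by rewrite size_takel // size_sort.
  suff /eqP -> : count (fun a => (t < a)%R) (take i.+1 (desc ws)) == size (take i.+1 (desc ws)).
    by rewrite sz.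
  rewrite -all_count; apply/(all_nthP 0) => k; rewrite sz => ki; rewrite nth_take //=.
  by apply: (lt_le_trans ti); exact: sorted_desc.
rewrite (permP (permEl (perm_sort _ ws))) => h.
by have := leq_trans h cJ; rewrite ltnNge Ji.
Qed.

Variables (E : {set {set V}}) (ws : seq R) (xs : seq V) (J : nat).
Hypothesis ws_gt0 : forall a, a \in ws -> 0 < a.

Definition untrapped_mass : R :=
  \sum_(x | x \notin take J xs) trap_measure E (vertex_weight ws xs) x.

Let wt := vertex_weight ws xs.

Let wt0 x : 0 <= wt x.
Proof.
rewrite /wt /vertex_weight; have [h|h] := ltnP (index x xs) (size (desc ws)).
  by have := mem_nth 0 h; rewrite mem_sort => /ws_gt0/ltW.
by rewrite nth_default.
Qed.

Lemma untrapped_mass_ge0 : 0 <= untrapped_mass.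
Proof.
apply: sumr_ge0 => x _; apply: divr_ge0; first by rewrite mulr_ge0 ?wt0.
by apply: sumr_ge0 => y _; rewrite mulr_ge0 ?wt0.
Qed.

Lemma untrapped_mass_le1 : untrapped_mass <= 1.
Proof.
rewrite /untrapped_mass -mulr_suml.
set S := \sum_y _ * _; have S0 : 0 <= S by apply: sumr_ge0 => y _; rewrite mulr_ge0 ?wt0.
have [->|Sn0] := eqVneq S 0; first by rewrite invr0 mulr0.
rewrite ler_pdivrMr ?mul1r; last by rewrite lt_neqAle eq_sym Sn0.
rewrite [leRHS](bigID (fun x => x \notin take J xs)) /= lerDl.
by apply: sumr_ge0 => y _; rewrite mulr_ge0 ?wt0.
Qed.

(** Regularity cancels the degrees and leaves a ratio of weights. Outside the first J vertices the
    weights are at most t, and a single weight above T bounds the total from below. *)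
Lemma untrapped_mass_bound (d : nat) (t T : R) :
  regular_graph E d -> (0 < d)%N -> uniq xs -> size xs = #|V| -> size ws = #|V| ->
  (count (fun a => (t < a)%R) ws <= J)%N -> 0 < T -> (exists2 a, a \in ws & T < a) ->
  untrapped_mass <= (\sum_(a <- ws) (if a <= t then a else 0)) / T.
Proof.
move=> rE d0 uxs sxs sws cJ T0 [a aws Ta].
have dR : d%:R != 0 :> R by rewrite pnatr_eq0 -lt0n.
pose S := \sum_(b <- ws) b.
have SE : \sum_y wt y = S.
  rewrite /S /wt /vertex_weight (sum_index (fun i => nth 0 (desc ws) i)) //.
  have /permPl/(perm_big _) <- := perm_sort (fun a b : R => b <= a) ws.
  by rewrite (big_nth 0) size_sort big_mkord sws.
have TS : T <= S.
  apply: le_trans (ltW Ta) _; rewrite /S (perm_big _ (perm_to_rem aws)) big_cons lerDl.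
  by rewrite big_seq; apply: sumr_ge0 => b /mem_rem /ws_gt0 /ltW.
have S0 : 0 < S by apply: lt_le_trans TS.
have -> : untrapped_mass = (\sum_(x | x \notin take J xs) wt x) / S.
  rewrite /untrapped_mass mulr_suml; apply: eq_bigr => x _.
  rewrite /trap_measure (degE rE).
  under eq_bigr => y _ do rewrite (degE rE).
  by rewrite -mulr_sumr -/wt SE; field; rewrite dR gt_eqF.
have -> : \sum_(x | x \notin take J xs) wt x =
    \sum_(i < size ws | (J <= i)%N) nth 0 (desc ws) i.
  rewrite sws big_mkcond [RHS]big_mkcond /=.
  rewrite -(sum_index (fun i => if (J <= i)%N then nth 0 (desc ws) i else 0) uxs sxs).
  by apply: eq_bigr => x _; rewrite in_take ?mem_enumeration // -leqNgt.
have tail := sum_desc_tail cJ (fun b bw => ltW (ws_gt0 bw)).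
have tail0 : 0 <= \sum_(b <- ws) (if b <= t then b else 0).
  by rewrite big_seq; apply: sumr_ge0 => b /ws_gt0 /ltW; case: ifP.
apply: (@le_trans _ _ ((\sum_(b <- ws) (if b <= t then b else 0)) / S)).
  by rewrite ler_wpM2r // invr_ge0 ltW.
by rewrite ler_wpM2l // lef_pV2 ?posrE.
Qed.

(** A value between 2^k and 2^(k+1) is bounded by the k-th term alone, a value at most 1 by the
    constant. Taking means, only tail probabilities at powers of 2 are involved. *)
Lemma truncated_le_dyadic (m : nat) (a : R) : 0 < a ->
  (if a <= 2 ^+ m then a else 0) <=
  1 + \sum_(k < m) 2 ^+ k.+1 * (if 2 ^+ k < a then 1 else 0).
Proof.
move=> a0; elim: m => [|m IH].
  by rewrite big_ord0 addr0 expr0; case: (leP a 1).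
have s0 : 0 <= \sum_(k < m) 2 ^+ k.+1 * (if 2 ^+ k < a then 1 else 0) :> R.
  by apply: sumr_ge0 => k _; rewrite mulr_ge0 ?exprn_ge0 //; case: ifP.
have e0 : 0 <= 2 ^+ m.+1 :> R by rewrite exprn_ge0.
rewrite big_ord_recr /=; case: (leP a (2 ^+ m)) IH => am IH.
  rewrite mulr0 addr0 (le_trans am) // exprS ler_peMl ?exprn_ge0 //; lra.
rewrite mulr1; case: (leP a (2 ^+ m.+1)) => h; lra.
Qed.

End HeavyWeights.

(** * Linearity of the mean for nonnegative variables *)

Section Means.
Local Open Scope classical_set_scope.
Context (disp : measure_display) (Omega : measurableType disp) (R : realType).
Variable P : probability Omega R.

Definition has_mean (f : Omega -> R) (v : R) :=
  [/\ measurable_fun setT f, forall w, 0 <= f w & 'E_P[f]%E = v%:E].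

Lemma has_mean_cst (c : R) : 0 <= c -> has_mean (fun=> c) c.
Proof. by move=> c0; split=> //; rewrite (expectation_cst P c). Qed.

Lemma has_mean_indic (A : set Omega) (v : R) :
  measurable A -> P A = v%:E -> has_mean \1_A v.
Proof.
move=> mA PA; split; first exact: measurable_realfun.measurable_indic.
  by move=> w; rewrite indicE.
by rewrite expectation_indic.
Qed.

Lemma has_meanD f g u v : has_mean f u -> has_mean g v ->
  has_mean (fun w => f w + g w) (u + v).
Proof.
move=> [mf f0 Ef] [mg g0 Eg]; split.
- exact: measurable_realfun.measurable_funD.
- by move=> w; rewrite addr_ge0.
move: Ef Eg; rewrite unlock => Ef Eg; under eq_integral do rewrite EFinD.
rewrite ge0_integralD //= ?Ef ?Eg //; try by move=> w _; rewrite lee_fin.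
- exact/measurable_realfun.measurable_EFinP.
- exact/measurable_realfun.measurable_EFinP.
Qed.

Lemma has_meanZ c f v : 0 <= c -> has_mean f v -> has_mean (fun w => c * f w) (c * v).
Proof.
move=> c0 [mf f0 Ef]; split.
- exact: measurable_realfun.measurable_funM.
- by move=> w; rewrite mulr_ge0.
move: Ef; rewrite unlock => Ef; under eq_integral do rewrite EFinM.
rewrite ge0_integralZl //= ?Ef ?lee_fin //; try by move=> w _; rewrite lee_fin.
exact/measurable_realfun.measurable_EFinP.
Qed.

Lemma has_mean_sum n (f : nat -> Omega -> R) (v : nat -> R) :
  (forall i, has_mean (f i) (v i)) ->
  has_mean (fun w => \sum_(i < n) f i w) (\sum_(i < n) v i).
Proof.
move=> fv; elim: n => [|n IH].
  rewrite big_ord0 (_ : (fun _ => _) = fun=> 0); first exact: has_mean_cst.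
  by apply/funext => w; rewrite big_ord0.
rewrite big_ord_recr (_ : (fun _ => _) = (fun w => \sum_(i < n) f i w + f n w)).
  exact: has_meanD.
by apply/funext => w; rewrite big_ord_recr.
Qed.

End Means.

Lemma le_sum5 (R : realDomainType) (f z1 z2 z3 z4 z5 : R) :
  0 <= z1 -> 0 <= z2 -> 0 <= z3 -> 0 <= z4 -> 0 <= z5 ->
  f <= z1 \/ f <= z2 \/ f <= z3 \/ f <= z4 \/ f <= z5 -> f <= z1 + z2 + z3 + z4 + z5.
Proof. by move=> ? ? ? ? ? [|[|[|[|]]]] ?; lra. Qed.

Section HeavyTails.
Local Open Scope classical_set_scope.
Variables (R : realType) (disp : measure_display) (Omega : measurableType disp).
Variables (P : probability Omega R) (V : nat -> finType).
Hypothesis cardV : forall N, (0 < N)%N -> #|V N| = N.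
Variable G : forall N, Omega -> {set {set V N}}.
Variables (d : nat) (good : forall N, set {set {set V N}}).
Arguments good : clear implicits.
Hypotheses (d_gt0 : (0 < d)%N) (G_rv : forall N, (0 < N)%N -> finite_rv (G N)).
Hypothesis good_regular : forall N g, good N g -> regular_graph g d.
Variable W : nat -> nat -> {RV P >-> R}.
Hypothesis W_gt0 : forall N j w, (0 < N)%N -> 0 < W N j w.
Hypothesis W_law : forall N j A, (0 < N)%N -> measurable A ->
  distribution P (W N j) A = distribution P (W 1%N 0%N) A.
Hypothesis W_indep : forall N, (0 < N)%N ->
  mutually_independent P (fun i : option nat =>
    if i is Some j then real_events (W N j) else finite_events (G N)).
Variable xs : forall N, Omega -> N.-tuple (V N).
Hypothesis xs_rv : forall N, (0 < N)%N -> finite_rv (xs N).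
Hypothesis xs_unif : forall N, (0 < N)%N ->
  uniform_on P (xs N) [set u : N.-tuple (V N) | uniq u]%SET.

Definition tail_prob (k : nat) : R := fine (P [set w | 2 ^+ k < W 1%N 0%N w]).

Lemma measurable_above N j (t : R) : measurable [set w | t < W N j w].
Proof.
rewrite (_ : [set w | _] = W N j @^-1` [set x | t < x]) //.
rewrite -[X in measurable X]setTI; apply: measurable_funP => //.
by rewrite -set_itvoy.
Qed.

Lemma measurable_below N j (t : R) : measurable [set w | W N j w <= t].
Proof.
rewrite (_ : [set w | _] = ~` [set w | t < W N j w]).
  by apply: measurableC; exact: measurable_above.
by apply/seteqP; split=> w /=; rewrite leNgt => /negP.
Qed.

Lemma prob_above N j k : (0 < N)%N ->
  P [set w | 2 ^+ k < W N j w] = (tail_prob k)%:E.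
Proof.
move=> N0; have mA : measurable [set x : R | 2 ^+ k < x] by rewrite -set_itvoy.
rewrite /tail_prob fineK; last by rewrite fin_num_measure //; exact: measurable_above.
exact: (W_law j N0 mA).
Qed.

Lemma tail_prob_ge0 k : 0 <= tail_prob k.
Proof. exact/fine_ge0. Qed.

Lemma tail_prob_le1 k : tail_prob k <= 1.
Proof.
rewrite -lee_fin -(prob_above 0 k (ltn0Sn 0)); apply: probability_le1.
exact: measurable_above.
Qed.

Lemma prob_all_below N k : (0 < N)%N ->
  P [set w | forall j, (j < N)%N -> W N j w <= 2 ^+ k] = ((1 - tail_prob k) ^+ N)%:E.
Proof.
(* [None], the index of the graph, lies outside J and gets a dummy event. *)
move=> N0; pose A (i : option nat) : set Omega :=
  if i is Some j then [set w | W N j w <= 2 ^+ k] else setT.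
pose s := [seq Some j | j <- iota 0 N].
pose J := [fset i in s]%fset.
have Js : perm_eq J s.
  apply: uniq_perm; first exact: fset_uniq.
    by rewrite map_inj_uniq ?iota_uniq // => a b [].
  by move=> i; rewrite !inE.
have AF (i : option nat) : i \in J -> (if i is Some j then real_events (W N j)
     else finite_events (G N)) (A i).
  rewrite (perm_mem Js) => /mapP[j _ ->] /=.
  exists [set x : R | x <= 2 ^+ k]; last by rewrite setTI.
  by rewrite -set_itvNyc.
have := W_indep N0 AF; rewrite (perm_big _ Js) big_map.
have -> : \bigcap_(i in [set` J]) A i = [set w | forall j, (j < N)%N -> W N j w <= 2 ^+ k].
  apply/seteqP; split=> w /= h.
    by move=> j jN; apply: (h (Some j)); rewrite /= (perm_mem Js) map_f // mem_iota.
  by move=> i; rewrite /= (perm_mem Js) => /mapP[j +  ->]; rewrite mem_iota => jN; apply: h.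
move=> ->; rewrite -[X in (1 - _) ^+ X](size_iota 0).
elim: (iota 0 N) => [|j l IH]; first by rewrite big_nil.
rewrite big_cons IH /= exprS EFinM; congr (_ * _)%E.
rewrite (_ : [set w | _] = ~` [set w | 2 ^+ k < W N j w]); last first.
  by apply/seteqP; split=> w /=; rewrite leNgt => /negP.
by rewrite probability_setC ?prob_above //; exact: measurable_above.
Qed.

Lemma prob_not_uniq N : (0 < N)%N -> P [set w | ~~ uniq (xs N w)] = 0%E.
Proof.
move=> N0; rewrite (prob_finite_rv P (fun u : N.-tuple (V N) => ~~ uniq u) (xs_rv N0)).
by rewrite big1 // => u /negPf un; rewrite xs_unif // inE un.
Qed.

(** Bounds the mean of a weight set to 0 above 2^m, through [truncated_le_dyadic]. *)
Definition dyadic_mean (m : nat) : R := 1 + \sum_(k < m) 2 ^+ k.+1 * tail_prob k.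

(** The mass is at most 1 on four exceptional events: a bad graph, a repetition in the enumeration
    (probability 0), more than J weights above 2^m (Markov), no weight above 2^(m + p)
    (independence). Elsewhere [untrapped_mass_bound] applies. *)
Lemma untrapped_mean_le N J m p : (0 < N)%N ->
  ('E_P[(fun w => untrapped_mass (G N w) [seq W N j w | j <- iota 0 #|V N|] (xs N w) J)%R]
   <= P (~` [set w | good N (G N w)]) +
      (J.+1%:R^-1 * (N%:R * tail_prob m) + (1 - tail_prob (m + p)) ^+ N +
       (2 ^+ (m + p))^-1 * (N%:R * dyadic_mean m))%:E)%E.
Proof.
move=> N0; pose T : R := 2 ^+ (m + p); have T0 : 0 < T by rewrite exprn_gt0.
pose U := [set w | good N (G N w)].
have mU : measurable U by exact: (finite_rv_measurable (good N) (G_rv N0)).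
have mUC : measurable (~` U) by exact: measurableC.
pose u := fine (P (~` U)).
have uE : P (~` U) = u%:E by rewrite fineK // fin_num_measure.
pose D := [set w | ~~ uniq (xs N w)].
have mD : measurable D.
  exact: (finite_rv_measurable [set z : N.-tuple (V N) | ~~ uniq z] (xs_rv N0)).
pose B := [set w | forall j, (j < N)%N -> W N j w <= T].
have mB : measurable B.
  rewrite (_ : B = \bigcap_(j in `I_N) [set w | W N j w <= T]) //.
  by apply: fin_bigcap_measurable => // j _; exact: measurable_below.
pose above k j : Omega -> R := \1_[set w | 2 ^+ k < W N j w].
have mabove k j : has_mean P (above k j) (tail_prob k).
  by apply: has_mean_indic; [exact: measurable_above|exact: prob_above].
(* One term for each event and one for the remaining case; each alone majorizes the mass in its
   case. *)
pose g w : R := \1_(~` U) w + \1_D w + J.+1%:R^-1 * (\sum_(j < N) above m j w) +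
  \1_B w + T^-1 * (\sum_(j < N) (1 + \sum_(k < m) 2 ^+ k.+1 * above k j w)).
have [mg g0 Eg] : has_mean P g (u + 0 + J.+1%:R^-1 * (\sum_(j < N) tail_prob m) +
    (1 - tail_prob (m + p)) ^+ N + T^-1 * (\sum_(j < N) dyadic_mean m)).
  apply: has_meanD; [apply: has_meanD; [apply: has_meanD; [apply: has_meanD|]|]|].
  - exact: has_mean_indic.
  - by apply: has_mean_indic => //; exact: prob_not_uniq.
  - apply: has_meanZ; rewrite ?invr_ge0 //.
    exact: (@has_mean_sum _ _ _ P N (above m) (fun=> tail_prob m)).
  - by apply: has_mean_indic => //; exact: prob_all_below.
  apply: has_meanZ; first by rewrite invr_ge0 ltW.
  apply: (@has_mean_sum _ _ _ P N (fun j w => 1 + \sum_(k < m) 2 ^+ k.+1 * above k j w)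
     (fun=> dyadic_mean m)) => j.
  apply: has_meanD; first exact: has_mean_cst.
  apply: (@has_mean_sum _ _ _ P m (fun k w => 2 ^+ k.+1 * above k j w)
    (fun k => 2 ^+ k.+1 * tail_prob k)) => k.
  by apply: has_meanZ; rewrite ?exprn_ge0.
have -> : (P (~` U) + (J.+1%:R^-1 * (N%:R * tail_prob m) + (1 - tail_prob (m + p)) ^+ N +
       T^-1 * (N%:R * dyadic_mean m))%:E = 'E_P[g])%E.
  by rewrite Eg uE -EFinD !sumr_const !card_ord addr0 !mulr_natl -!addrA.
have iotaE : iota 0 N = index_iota 0 N by rewrite /index_iota subn0.
have ws0 w a : a \in [seq W N j w | j <- iota 0 #|V N|] -> 0 < a.
  by move=> /mapP[j _ ->]; exact: W_gt0.
apply: le_expectation => w; first by apply: untrapped_mass_ge0; exact: ws0.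
have ab0 k j : 0 <= above k j w by rewrite /above indicE.
have aboveE k j : above k j w = (if 2 ^+ k < W N j w then 1 else 0).
  by rewrite /above indicE; case: ifP => h; [rewrite mem_set|rewrite memNset //= h].
have t1 : 0 <= \1_(~` U) w :> R by rewrite indicE.
have t2 : 0 <= \1_D w :> R by rewrite indicE.
have t3 : 0 <= J.+1%:R^-1 * (\sum_(j < N) above m j w).
  by rewrite mulr_ge0 ?invr_ge0 // sumr_ge0.
have t4 : 0 <= \1_B w :> R by rewrite indicE.
have t5 : 0 <= T^-1 * (\sum_(j < N) (1 + \sum_(k < m) 2 ^+ k.+1 * above k j w)).
  rewrite mulr_ge0 ?invr_ge0 ?(ltW T0) // sumr_ge0 // => j _.
  by rewrite addr_ge0 // sumr_ge0 // => k _; rewrite mulr_ge0 ?exprn_ge0.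
have f1 := untrapped_mass_le1 (G N w) (xs N w) J (ws0 w).
rewrite /g /=; set f := untrapped_mass _ _ _ _ in f1 *.
apply: le_sum5 => //.
have [gw|gw] := pselect (U w); last by left; rewrite indicE mem_set.
have [uw|uw] := boolP (uniq (xs N w)); last by right; left; rewrite indicE mem_set.
have [bw|bw] := pselect (B w); first by do 3 right; left; rewrite indicE mem_set.
have [cJ|cJ] := leqP (count (fun a => (2 ^+ m < a)%R) [seq W N j w | j <- iota 0 #|V N|]) J;
    last first.
  do 2 right; left; apply: le_trans f1 _.
  rewrite ler_pdivlMl ?ltr0n // mulr1.
  have -> : \sum_(j < N) above m j w =
      (count (fun a => (2 ^+ m < a)%R) [seq W N j w | j <- iota 0 #|V N|])%:R.
    rewrite cardV // count_map -sum1_count [in RHS]big_mkcond natr_sum iotaE.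
    rewrite big_mkord; apply: eq_bigr => j _; rewrite aboveE /=.
    by case: ifP.
  by rewrite ler_nat.
do 4 right.
have [a aws Ta] : exists2 a, a \in [seq W N j w | j <- iota 0 #|V N|] & T < a.
  move/existsNP: bw => [j] /not_implyP[jN] /negP; rewrite -ltNge => h.
  by exists (W N j w) => //; apply/mapP; exists j => //; rewrite mem_iota cardV.
have sx : size (xs N w) = #|V N| by rewrite size_tuple cardV.
have sw : size [seq W N j w | j <- iota 0 #|V N|] = #|V N| by rewrite size_map size_iota.
have h := untrapped_mass_bound (ws0 w) (good_regular gw) d_gt0 uw sx sw cJ T0
  (ex_intro2 _ _ a aws Ta).
apply: (le_trans h); rewrite mulrC cardV // ler_wpM2l ?invr_ge0 ?(ltW T0) //.
rewrite big_map iotaE big_mkord.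
apply: ler_sum => j _; under eq_bigr => k _ do rewrite aboveE.
by apply: truncated_le_dyadic; exact: W_gt0.
Qed.

End HeavyTails.

(** * Choice of the dyadic scales *)

Section DyadicTails.
Local Open Scope classical_set_scope.
Variables (R : realType) (a : nat -> R) (q1 q2 : R) (k0 : nat).
Hypotheses (a_ge0 : forall k, 0 <= a k) (a_le1 : forall k, a k <= 1).
Hypotheses (q1_gt : 2^-1 < q1) (q2_lt1 : q2 < 1).
Hypothesis ratio : forall k, (k0 <= k)%N ->
  [/\ 0 < a k, q1 * a k <= a k.+1 & a k.+1 <= q2 * a k].

Let q1_gt0 : 0 < q1. Proof. by apply: lt_trans q1_gt; rewrite invr_gt0. Qed.

Let q2_ge0 : 0 <= q2.
Proof.
have [ak _ h] := ratio (leqnn k0).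
by rewrite -(pmulr_lge0 _ ak) (le_trans _ h).
Qed.

Lemma tail_ge k p : (k0 <= k)%N -> q1 ^+ p * a k <= a (k + p)%N.
Proof.
move=> kk; elim: p => [|p IH]; first by rewrite mul1r addn0.
rewrite exprS -mulrA addnS; have [_ h _] := ratio (leq_trans kk (leq_addr p k)).
by apply: le_trans h; rewrite ler_wpM2l // ltW.
Qed.

Lemma tail_le p : a (k0 + p)%N <= q2 ^+ p.
Proof.
elim: p => [|p IH]; first by rewrite addn0.
rewrite exprS addnS; have [_ _ h] := ratio (leq_addr p k0).
by apply: le_trans h _; rewrite ler_wpM2l.
Qed.

Let U m := 1 + \sum_(k < m) 2 ^+ k.+1 * a k.

(* Since alpha < 1, the truncated mean is dominated by its last dyadic block. *)
Lemma truncated_mean_le : exists2 C : R, 0 < C &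
  forall m, (k0 <= m)%N -> U m <= C * (2 ^+ m * a m).
Proof.
have q21 : 0 < 2 * q1 - 1 by move: q1_gt; lra.
have b0 m : (k0 <= m)%N -> 0 < 2 ^+ m * a m.
  by move=> km; have [h _ _] := ratio km; rewrite mulr_gt0 ?exprn_gt0.
(* The first entry starts the induction at k0; the second gives C + 2 <= 2 q1 C, which closes the
   step. *)
pose C := Num.max (U k0 / (2 ^+ k0 * a k0)) (2 / (2 * q1 - 1)).
have C2 : 2 / (2 * q1 - 1) <= C by rewrite le_max lexx orbT.
exists C; first by apply: lt_le_trans C2; rewrite divr_gt0.
move=> m km; rewrite -(subnKC km); elim: (m - k0)%N => [|j IH].
  by rewrite addn0 -ler_pdivrMr ?b0 // le_max lexx.
rewrite addnS; set n := (k0 + j)%N in IH *.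
have kn : (k0 <= n)%N by exact: leq_addr.
have [an h _] := ratio kn.
have -> : U n.+1 = U n + 2 * (2 ^+ n * a n).
  by rewrite /U big_ord_recr /= exprS; ring.
apply: le_trans (lerD IH (lexx _)) _.
have e : 0 <= 2 ^+ n :> R by rewrite exprn_ge0.
apply: (@le_trans _ _ (C * (2 * q1) * (2 ^+ n * a n))).
  rewrite -mulrDl ler_wpM2r ?(ltW (b0 n kn)) //.
  by move: C2; rewrite ler_pdivrMr //; lra.
have C0 : 0 <= C by apply: le_trans C2; rewrite divr_ge0 // ltW.
rewrite -!mulrA ler_wpM2l // exprS -mulrA ler_wpM2l //.
by rewrite mulrCA ler_wpM2l.
Qed.

(** Bernoulli's inequality for (1 + x)^N, combined with (1 - x) (1 + x) <= 1. *)
Lemma expr_1B_le (x : R) N : 0 <= x <= 1 -> (1 - x) ^+ N <= (1 + N%:R * x)^-1.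
Proof.
move=> /andP[x0 x1].
have h : 1 + N%:R * x <= (1 + x) ^+ N.
  elim: N => [|N IH]; first by rewrite mul0r addr0.
  rewrite exprS -natr1; apply: (@le_trans _ _ ((1 + x) * (1 + N%:R * x))).
    have : 0 <= N%:R * x ^+ 2 by rewrite mulr_ge0 ?sqr_ge0.
    by rewrite expr2; lra.
  by rewrite ler_wpM2l // addr_ge0.
have p0 : 0 < 1 + N%:R * x by rewrite ltr_pwDl // mulr_ge0.
rewrite -[leRHS]mul1r ler_pdivlMr //.
apply: (@le_trans _ _ ((1 - x) ^+ N * (1 + x) ^+ N)).
  by rewrite ler_wpM2l // exprn_ge0 // subr_ge0.
rewrite -exprMn exprn_ile1 //; first by rewrite mulr_ge0 ?subr_ge0 ?addr_ge0.
have : 0 <= x ^+ 2 by rewrite sqr_ge0.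
by rewrite expr2; lra.
Qed.

Lemma near_small (x e : R) : 0 <= x < 1 -> 0 < e -> \forall p \near \oo, x ^+ p <= e.
Proof.
move=> /andP[x0 x1] e0.
have h : `|x| < 1 by rewrite ger0_norm.
have /cvgrPdist_le/(_ e e0) := cvg_expr h.
apply: filterS => p; rewrite sub0r normrN ger0_norm ?exprn_ge0 //.
Qed.

(* With kappa between 1/q1 and 2 and about kappa ^ p weights above the level
   2 ^ m, the largest weight exceeds 2 ^ (m + p), while the weights below 2 ^ m
   have total mass of order kappa ^ p * 2 ^ m. *)
Lemma choose_scales (e : R) : 0 < e -> exists p (K : R),
  \forall N \near \oo, exists m,
    [/\ N%:R * a m <= K, (1 - a (m + p)%N) ^+ N <= e &
        (2 ^+ (m + p))^-1 * (N%:R * U m) <= e].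
Proof.
move=> e0; have [C C0 UC] := truncated_mean_le.
(* The midpoint between 1/q1 and 2, which are in this order because q1 > 1/2. *)
pose kap := (q1^-1 + 2) / 2.
have q1i : q1^-1 < 2 by rewrite -[ltRHS]invrK ltf_pV2 ?posrE ?invr_gt0.
have k_lt2 : kap < 2 by rewrite /kap; lra.
have k_gt : q1^-1 < kap by rewrite /kap; lra.
have k_gt0 : 0 < kap by apply: lt_trans k_gt; rewrite invr_gt0.
have qk : 1 < q1 * kap by rewrite -ltr_pdivrMl // mulr1.
have qk0 : 0 < q1 * kap by apply: lt_trans qk.
(* The first bound makes the weights below 2^m negligible against 2^(m + p); the second makes it
   unlikely that no weight exceeds 2^(m + p). *)
have [p [p1 p2]] : exists p, (kap / 2) ^+ p <= e / C /\ (q1 * kap)^-1 ^+ p <= e * q1.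
  have h1 : \forall p \near \oo, (kap / 2) ^+ p <= e / C.
    apply: near_small; last by rewrite divr_gt0.
    by rewrite divr_ge0 ?(ltW k_gt0) //= ltr_pdivrMr // mul1r.
  have h2 : \forall p \near \oo, (q1 * kap)^-1 ^+ p <= e * q1.
    apply: near_small; last by rewrite mulr_gt0.
    by rewrite invr_ge0 ltW //= invf_lt1.
  have [p hp] := filter_ex (filterI h1 h2).
  by exists p.
pose K := kap ^+ p; have K0 : 0 < K by rewrite exprn_gt0.
exists p, K.
have [a1 _ _] := ratio (leqnSn k0).
near=> N.
(* This excludes the level k0 + 1, so the level just below the one selected is still above k0. *)
have NK : K / a k0.+1 < N%:R by near: N; exact: nbhs_infty_gtr.
have N0 : 0 < N%:R :> R by apply: lt_trans NK; rewrite divr_gt0.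
have exm : exists m, (k0 < m)%N && (N%:R * a m <= K).
  have q2b : 0 <= q2 < 1 by rewrite q2_ge0.
  have hj : \forall j \near \oo, q2 ^+ j <= K / N%:R by apply: near_small => //; rewrite divr_gt0.
  have [j [jK j1]] := filter_ex (filterI hj (nbhs_infty_gt 0)).
  exists (k0 + j)%N; rewrite -[X in (X < _)%N]addn0 ltn_add2l j1 /=.
  by rewrite mulrC -ler_pdivlMr // (le_trans (tail_le j)).
(* By minimality N times the tail exceeds K one level lower, which yields the lower bound on the
   number of large weights. *)
case: (ex_minnP exm) => m /andP[km NmK] mmin.
case: m km NmK mmin => // m km NmK mmin.
have k0m : (k0 < m)%N.
  rewrite ltn_neqAle -ltnS km andbT; apply/eqP => mk.
  by move: NmK; rewrite -mk leNgt -ltr_pdivrMr // NK.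
have NmK' : K < N%:R * a m.
  rewrite ltNge; apply/negP => h; have := mmin m; rewrite k0m h => /(_ isT).
  by rewrite ltnn.
have [_ am1 _] := ratio (ltnW k0m).
exists m.+1; split=> //.
  apply: le_trans (expr_1B_le N _) _; first by rewrite a_ge0 a_le1.
  have big : q1 * (q1 * kap) ^+ p <= N%:R * a (m.+1 + p)%N.
    apply: (@le_trans _ _ (N%:R * (q1 ^+ p * a m.+1))); last first.
      by rewrite ler_wpM2l // tail_ge // ltnW.
    apply: (@le_trans _ _ (N%:R * (q1 ^+ p * (q1 * a m)))); last first.
      by rewrite ler_wpM2l // ler_wpM2l // exprn_ge0 // ltW.
    have -> : N%:R * (q1 ^+ p * (q1 * a m)) = q1 * q1 ^+ p * (N%:R * a m) by ring.
    have -> : q1 * (q1 * kap) ^+ p = q1 * q1 ^+ p * K by rewrite exprMn mulrA.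
    apply: ler_wpM2l; last exact: ltW.
    by rewrite mulr_ge0 ?exprn_ge0 // ltW.
  have b0 : 0 < q1 * (q1 * kap) ^+ p by rewrite mulr_gt0 ?exprn_gt0.
  apply: (@le_trans _ _ (q1 * (q1 * kap) ^+ p)^-1).
    rewrite lef_pV2 ?posrE // ?ltr_pwDl ?mulr_ge0 //.
    by apply: le_trans big _; rewrite lerDr.
  by rewrite invfM -exprVn mulrC ler_pdivrMr.
have e1 : 0 < 2 ^+ (m.+1 + p) :> R by rewrite exprn_gt0.
rewrite mulrC ler_pdivrMr //.
apply: (@le_trans _ _ (N%:R * (C * (2 ^+ m.+1 * a m.+1)))).
  by rewrite ler_wpM2l // UC // ltnW.
have -> : N%:R * (C * (2 ^+ m.+1 * a m.+1)) = C * (2 ^+ m.+1) * (N%:R * a m.+1) by ring.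
apply: (@le_trans _ _ (C * 2 ^+ m.+1 * K)).
  by rewrite ler_wpM2l // mulr_ge0 ?exprn_ge0 // ltW.
move: p1; rewrite expr_div_n -/K ler_pdivrMr ?exprn_gt0 // mulrAC ler_pdivlMr // => p1.
have -> : C * 2 ^+ m.+1 * K = 2 ^+ m.+1 * (K * C) by ring.
have -> : e * 2 ^+ (m.+1 + p) = 2 ^+ m.+1 * (e * 2 ^+ p) by rewrite exprD; ring.
by rewrite ler_wpM2l // exprn_ge0.
Unshelve. all: by end_near. Qed.

End DyadicTails.

(** * Regular variation and the limit in (ii) *)

Section HeavyTailLimit.
Local Open Scope classical_set_scope.
Variable R : realType.

Lemma cvge0P (u : nat -> \bar R) : (\forall N \near \oo, (0 <= u N)%E) ->
  (u N @[N --> \oo] --> 0%E) <->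
  (forall e : R, 0 < e -> \forall N \near \oo, (u N <= e%:E)%E).
Proof.
move=> u0; split=> [/fine_cvgP[ufin /cvgrPdist_le u_0] e e0|ue].
  near=> N; have uN : u N \is a fin_num by near: N.
  have h : `|0 - (fine \o u) N| <= e by near: N; exact: u_0.
  rewrite -(fineK uN) lee_fin; apply: le_trans h.
  by rewrite sub0r normrN /= ler_norm.
have fin : \forall N \near \oo, u N \is a fin_num.
  near=> N; have u0N : (0 <= u N)%E by near: N.
  rewrite ge0_fin_numE //; apply: (@le_lt_trans _ _ (1%:E : \bar R)); last by rewrite ltry.
  by near: N; exact: ue.
apply/fine_cvgP; split=> //; apply/cvgrPdist_le => e e0; near=> N.
have uN : u N \is a fin_num by near: N.
have u0N : (0 <= u N)%E by near: N.
rewrite sub0r normrN /= ger0_norm ?fine_ge0 // -lee_fin fineK //.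
by near: N; exact: ue.
Unshelve. all: by end_near. Qed.

Lemma cvg_expr2y : 2 ^+ k @[k --> \oo] --> (+oo : set_system R).
Proof.
apply/cvgryPge => A; near=> k; have Ak : A <= k%:R by near: k; exact: nbhs_infty_ger.
by apply: le_trans Ak _; rewrite -natrX ler_nat ltnW // ltn_expl.
Unshelve. all: by end_near. Qed.

Lemma powR2N (alpha : R) : 0 < alpha -> alpha < 1 -> 2^-1 < (2 : R) `^ (- alpha) < 1.
Proof.
move=> a0 a1; have l2 : 0 < ln (2 : R) by rewrite ln_gt0 // ltr1n.
have h b : (2 : R) `^ b = expR (b * ln 2) by rewrite /powR gt_eqF.
have -> : (2^-1 : R) = expR (- ln 2) by rewrite expRN lnK // posrE.
rewrite h ltr_expR -[X in _ && (_ < X)]expR0 ltr_expR mulNr ltrN2 oppr_lt0.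
by rewrite mulr_gt0 // andbT gtr_pMl.
Qed.

(** Slow variation along t = 2^k with factor 2 makes the ratios tend to 2^(-alpha). The constants q1
    and q2 are the midpoints between this limit and 1/2, respectively 1. *)
Lemma regular_variation_ratio (L : R -> R) (alpha : R) (a : nat -> R) :
  slowly_varying L -> 0 < alpha -> alpha < 1 ->
  (forall k, a k = L (2 ^+ k) * (2 ^+ k) `^ (- alpha)) ->
  exists q1 q2 k0, [/\ 2^-1 < q1, q2 < 1 &
    forall k, (k0 <= k)%N -> [/\ 0 < a k, q1 * a k <= a k.+1 & a k.+1 <= q2 * a k]].
Proof.
move=> [Lpos Lsv] a0 a1 aE; have /andP[l1 l2] := powR2N a0 a1.
set l : R := 2 `^ (- alpha) in l1 l2.
pose q1 := (2^-1 + l) / 2; pose q2 := (l + 1) / 2.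
have q1l : q1 < l by rewrite /q1; lra.
have lq2 : l < q2 by rewrite /q2; lra.
have l0 : 0 < l by rewrite powR_gt0.
have pos : \forall k \near \oo, 0 < L (2 ^+ k) by exact: (cvg_expr2y Lpos).
have lim : L (2 * 2 ^+ k) / L (2 ^+ k) * l @[k --> \oo] --> l.
  rewrite -[X in _ --> X]mul1r; apply: cvgMl.
  exact: (cvg_comp (fun k : nat => (2 : R) ^+ k) (fun t => L (2 * t) / L t)
    cvg_expr2y (Lsv 2 _)).
have rE k : 0 < L (2 ^+ k) -> a k.+1 = (L (2 * 2 ^+ k) / L (2 ^+ k) * l) * a k.
  move=> Lk; rewrite !aE exprS powRM ?exprn_ge0 // -/l.
  by field; rewrite gt_eqF.
have low : \forall k \near \oo, q1 <= L (2 * 2 ^+ k) / L (2 ^+ k) * l.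
  have /cvgrPdist_le/(_ (l - q1)) := lim; rewrite subr_gt0 => /(_ q1l).
  by apply: filterS => k; rewrite ler_norml => /andP[_]; lra.
have high : \forall k \near \oo, L (2 * 2 ^+ k) / L (2 ^+ k) * l <= q2.
  have /cvgrPdist_le/(_ (q2 - l)) := lim; rewrite subr_gt0 => /(_ lq2).
  by apply: filterS => k; rewrite ler_norml => /andP[]; lra.
have [k0 _ hk] : \forall k \near \oo,
    [/\ 0 < a k, q1 * a k <= a k.+1 & a k.+1 <= q2 * a k].
  near=> k; have Lk : 0 < L (2 ^+ k) by near: k.
  have ak : 0 < a k by rewrite aE mulr_gt0 // powR_gt0 exprn_gt0.
  split=> //; rewrite rE // ler_wpM2r ?(ltW ak) //.
    by near: k.
  by near: k.
exists q1, q2, k0; split=> //; rewrite /q1 /q2; lra.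
Unshelve. all: by end_near. Qed.

Variables (disp : measure_display) (Omega : measurableType disp).
Variables (P : probability Omega R) (V : nat -> finType).
Hypothesis cardV : forall N, (0 < N)%N -> #|V N| = N.
Variable G : forall N, Omega -> {set {set V N}}.
Variables (d : nat) (good : forall N, set {set {set V N}}).
Arguments good : clear implicits.
Hypotheses (d_gt0 : (0 < d)%N) (G_rv : forall N, (0 < N)%N -> finite_rv (G N)).
Hypothesis good_regular : forall N g, good N g -> regular_graph g d.
Hypothesis G_prop : P [set w | good N (G N w)] @[N --> \oo] --> 1%E.
Variables (alpha : R) (L : R -> R).
Hypotheses (alpha_gt0 : 0 < alpha) (alpha_lt1 : alpha < 1) (L_sv : slowly_varying L).
Variable W : nat -> nat -> {RV P >-> R}.
Hypothesis W_gt0 : forall N j w, (0 < N)%N -> 0 < W N j w.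
Hypothesis W_law : forall N j A, (0 < N)%N -> measurable A ->
  distribution P (W N j) A = distribution P (W 1%N 0%N) A.
Hypothesis W_tail : forall t : R, 0 < t ->
  P [set w | t < W 1%N 0%N w] = (L t * t `^ (- alpha))%:E.
Hypothesis W_indep : forall N, (0 < N)%N ->
  mutually_independent P (fun i : option nat =>
    if i is Some j then real_events (W N j) else finite_events (G N)).
Variable xs : forall N, Omega -> N.-tuple (V N).
Hypothesis xs_rv : forall N, (0 < N)%N -> finite_rv (xs N).
Hypothesis xs_unif : forall N, (0 < N)%N ->
  uniform_on P (xs N) [set u : N.-tuple (V N) | uniq u]%SET.

Lemma untrapped_mass_cvg0 (J : nat -> nat) : J N @[N --> \oo] --> \oo ->
  'E_P[(fun w => untrapped_mass (G N w) [seq W N j w | j <- iota 0 #|V N|]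
         (xs N w) (minn (J N) #|V N|))%R]%E @[N --> \oo] --> 0%E.
Proof.
move=> Jy.
have aE k : tail_prob W k = L (2 ^+ k) * (2 ^+ k) `^ (- alpha).
  by rewrite /tail_prob W_tail ?exprn_gt0.
have [q1 [q2 [k0 [q1g q2l rat]]]] := regular_variation_ratio L_sv alpha_gt0 alpha_lt1 aE.
have npos : \forall N \near \oo, (0 < N)%N by exact: nbhs_infty_gt.
have bad : P (~` [set w | good N (G N w)]) @[N --> \oo] --> 0%E.
  apply: cvg_prob_setC => //; near=> N; have N0 : (0 < N)%N by near: N.
  exact: (finite_rv_measurable (good N) (G_rv N0)).
apply/cvge0P => [|e e0].
  near=> N; have N0 : (0 < N)%N by near: N.
  apply: expectation_ge0 => w; apply: untrapped_mass_ge0 => a /mapP[j _ ->].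
  exact: W_gt0.
(* One quarter each for the bad graphs, the count above 2^m, the maximum and the small weights. *)
have e4 : 0 < e / 4 by rewrite divr_gt0.
have [p [K HK]] := choose_scales (tail_prob_ge0 W) (tail_prob_le1 W_law) q1g q2l rat e4.
have bad4 : \forall N \near \oo, (P (~` [set w | good N (G N w)]) <= (e / 4)%:E)%E.
  by apply: (proj1 (cvge0P _) bad) => //; exact: nearW.
(* Markov's term is at most K / (J + 1), and K was fixed by e alone before N. *)
have Jbig : \forall N \near \oo, K / (e / 4) <= (minn (J N) N).+1%:R.
  have [A hA] : exists A : nat, K / (e / 4) <= A%:R.
    have [A] := filter_ex (nbhs_infty_ger (K / (e / 4))); by exists A.
  near=> N; apply: le_trans hA _; rewrite ler_nat; apply: leqW; rewrite leq_min.
  apply/andP; split; last by near: N; exact: nbhs_infty_ge.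
  by near: N; exact: (proj1 (cvgnyPge _) Jy A).
near=> N; have N0 : (0 < N)%N by near: N.
have [m [h1 h2 h3]] : exists m,
    [/\ N%:R * tail_prob W m <= K, (1 - tail_prob W (m + p)%N) ^+ N <= e / 4 &
        (2 ^+ (m + p))^-1 * (N%:R * dyadic_mean W m) <= e / 4].
  by near: N; exact: HK.
have b4 : (P (~` [set w | good N (G N w)]) <= (e / 4)%:E)%E by near: N.
have J4 : K / (e / 4) <= (minn (J N) N).+1%:R by near: N.
apply: le_trans (untrapped_mean_le cardV d_gt0 G_rv good_regular W_gt0 W_law W_indep
  xs_rv xs_unif (minn (J N) #|V N|) m p N0) _.
apply: (@le_trans _ _ ((e / 4)%:E + (e / 4 + e / 4 + e / 4)%:E)%E); last first.
  by rewrite -EFinD lee_fin; lra.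
apply: leeD => //; rewrite lee_fin; apply: lerD => //; apply: lerD => //.
rewrite cardV // ler_pdivrMl ?ltr0n //; apply: (le_trans h1).
by rewrite mulrC -ler_pdivrMl // mulrC.
Unshelve. all: by end_near. Qed.

End HeavyTailLimit.

Local Open Scope classical_set_scope.

Theorem proposition9p3
  (R : realType) (disp : measure_display) (Omega : measurableType disp)
  (P : probability Omega R)
  (* the random graphs G_N = (V_N, E_N), N >= 1 *)
  (V : nat -> finType)
  (cardV : forall N, (0 < N)%N -> #|V N| = N)
  (G : forall N, Omega -> {set {set V N}})
  (G_rv : forall N, (0 < N)%N -> finite_rv (G N))
  (G_simple : forall N w, (0 < N)%N -> simple_graph (G N w))
  (G_connected : forall N w, (0 < N)%N -> connected_graph (G N w))
  (* (G1), (G2), (G3) *)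
  (d : nat) (alpha0 gamma : R)
  (d_ge3 : (3 <= d)%N) (alpha0_gt0 : 0 < alpha0) (gamma_gt0 : 0 < gamma)
  (G_prop : P [set w | [/\ regular_graph (G N w) d,
                           forall x : V N, at_most_one_cycle (G N w)
                             (gball (G N w) x (alpha0 * ln N%:R)) &
                           gamma <= spectral_gap R (G N w)]]
            @[N --> \oo] --> 1%E)
  (* the weights; W N j is the weight of index j + 1 in the N-th family *)
  (alpha : R) (L : R -> R)
  (alpha_gt0 : 0 < alpha) (alpha_lt1 : alpha < 1) (L_sv : slowly_varying L)
  (W : nat -> nat -> {RV P >-> R})
  (W_gt0 : forall N j w, (0 < N)%N -> 0 < W N j w)
  (W_law : forall N j A, (0 < N)%N -> measurable A ->
             distribution P (W N j) A = distribution P (W 1%N 0%N) A)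
  (W_tail : forall t : R, 0 < t ->
              P [set w | t < W 1%N 0%N w] = (L t * t `^ (- alpha))%:E)
  (W_indep : forall N, (0 < N)%N ->
     mutually_independent P (fun i : option nat =>
       if i is Some j then real_events (W N j) else finite_events (G N)))
  (* the enumeration (x^N_1, ..., x^N_N) of V_N *)
  (xs : forall N, Omega -> N.-tuple (V N))
  (xs_rv : forall N, (0 < N)%N -> finite_rv (xs N))
  (xs_unif : forall N, (0 < N)%N ->
     uniform_on P (xs N) [set u : N.-tuple (V N) | uniq u]%SET)
  (xs_indep : forall N, (0 < N)%N ->
     mutually_independent P (fun i : option nat =>
       if i is Some j then real_events (W N j) else finite_events (xs N)))
  (* the random vertices X and Y *)
  (X Y : forall N, Omega -> V N)
  (X_rv : forall N, (0 < N)%N -> finite_rv (X N))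
  (Y_rv : forall N, (0 < N)%N -> finite_rv (Y N))
  (X_unif : forall N, (0 < N)%N -> uniform_on P (X N) [set: V N]%SET)
  (Y_unif : forall N, (0 < N)%N -> uniform_on P (Y N) [set: V N]%SET)
  (XY_indep : forall N, (0 < N)%N ->
     mutually_independent P (fun i : option bool =>
       if i is Some b then finite_events (if b then X N else Y N)
       else finite_events (G N)))
  (alpha' : R) (alpha'_gt0 : 0 < alpha')
  (alpha'_lt : alpha' < Num.min alpha0 (2 * ln (d%:R - 1))^-1) :
  let ell N : R := alpha' * ln N%:R in
  [/\ (* (i) *)
      P [set w | ~ pointed_equiv (G N w)
                     (X N w) (gball (G N w) (X N w) (ell N))
                     (Y N w) (gball (G N w) (Y N w) (ell N))]
        @[N --> \oo] --> 0%E,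
      (* (ii) *)
      forall J : nat -> nat,
        {homo J : m n / (m <= n)%N} -> J N @[N --> \oo] --> \oo ->
        'E_P[(fun w => \sum_(x : V N | x \notin take (minn (J N) #|V N|) (xs N w))
               trap_measure (G N w)
                 (vertex_weight [seq W N j w | j <- iota 0 #|V N|] (xs N w)) x)%R]%E
        @[N --> \oo] --> 0%E,
      (* (iii) *)
      'E_P[(fun w =>
               #|gball (G N w) (X N w) (2 * ell N)|%:R / #|V N|%:R)%R]%E
        @[N --> \oo] --> 0%E &
      (* (iv) *)
      'E_P[(fun w => \big[Num.max/0]_(y | y \notin gball (G N w) (X N w) (ell N))
               hit_prob (G N w) y (X N w)
                 (ln N%:R * (mixing_time R (G N w))%:R))%R]%E
        @[N --> \oo] --> 0%E].
Proof.
have q2 : 2 <= d%:R - 1 :> R.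
  have : 3%:R <= d%:R :> R by rewrite ler_nat.
  lra.
have d_gt0 : (0 < d)%N by apply: leq_trans d_ge3.
have [alpha'_lt0 alpha'_ltd] : alpha' < alpha0 /\ alpha' < (2 * ln (d%:R - 1))^-1.
  by apply/andP; rewrite -lt_min.
split.
- exact: (local_equiv_cvg cardV G_rv G_simple G_connected d_ge3 alpha0_gt0 G_prop
    alpha'_gt0 alpha'_lt0 X_rv Y_rv X_unif Y_unif XY_indep).
- move=> J _ Jy.
  exact: (untrapped_mass_cvg0 cardV (good := @good_graph R V d alpha0 gamma) d_gt0 G_rv
    (fun N g gg => let: And3 rg _ _ := gg in rg) G_prop alpha_gt0 alpha_lt1 L_sv
    W_gt0 W_law W_tail W_indep xs_rv xs_unif Jy).
- exact: (ball_fraction_cvg0 cardV G_rv G_connected d_ge3 G_prop X alpha'_gt0 alpha'_ltd).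
exact: (hitting_cvg0 cardV G_rv G_connected d_ge3 gamma_gt0 G_prop X alpha'_gt0).
Qed.
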